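(* Let $X,U$ be Hilbert spaces. Assume that $A$ generates an analytic semigroup $T(t)$ on $X$, $B\in\mathcal{B}(U,X_{-1})$, and $F\in\mathcal{B}(X,U)$ is compact. Assume that the semigroup generated by the operator $A_{BF}$ on $X$, $A_{BF}x:=(A+BF)x$ with domain $\{x\in X:(A+BF)x\in X\}$, is exponentially stable. Choose $h>0$ so that the linear periodic sampled-data system, i.e., the closed-loop system with $\phi\equiv0$ and $t_{k+1}-t_k=h$ for all $k\in\mathbb{N}_0$, is exponentially stable. Then there exist $\varepsilon^*=\varepsilon^*(h)>0$ and $L^*=L^*(h)>0$ such that for every $\varepsilon\in[0,\varepsilon^*]$, every $L\in[0,L^*]$, every $\phi:X\to X$ satisfying $\phi(0)=0$ and $\|\phi(\xi_1)-\phi(\xi_2)\|\le L\|\xi_1-\xi_2\|$ for all $\xi_1,\xi_2\in X$, and every $\ell_{\max}\in\mathbb{N}$, the closed-loop system with the periodic event-triggering mechanism (described in the context) with parameters $h,\varepsilon,\ell_{\max}$ is exponentially stable.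
   Context: $\mathcal{B}(Y,Z)$ is the space of bounded linear operators from $Y$ to $Z$, $\mathcal{B}(X)=\mathcal{B}(X,X)$, $\mathbb{N}=\{1,2,\dots\}$, $\mathbb{N}_0=\mathbb{N}\cup\{0\}$, and $\|\cdot\|$ is the norm of $X$. The extrapolation space $X_{-1}$ associated with $T(t)$ is the completion of $X$ with respect to the norm $\|x\|_{-1}:=\|(\lambda I-A)^{-1}x\|$, where $\lambda$ is a fixed element of the resolvent set of $A$. $T(t)$ extends to a strongly continuous semigroup on $X_{-1}$ whose generator is an extension of $A$ with domain $X$; the same symbols are used for the extensions. A strongly continuous semigroup $V(t)$ on $X$ is exponentially stable if $\|V(t)\|_{\mathcal{B}(X)}\le\Gamma e^{-\gamma t}$ for all $t\ge0$, for some $\Gamma\ge1$, $\gamma>0$. Closed-loop system: $\dot x(t)=Ax(t)+Bu(t)+\phi(x(t))$, $t\ge0$, $x(0)=x^0\in X$, with $u(t)=Fx(t_k)$ for $t_k\le t<t_{k+1}$, $k\in\mathbb{N}_0$ ($t_0=0$). Its (mild) solution is the unique function $x\in C([0,\infty),X)$ with $x(0)=x^0$ and $$x(t_k+\tau)=T(\tau)x(t_k)+\int_0^\tau T(\tau-s)\big(BFx(t_k)+\phi(x(t_k+s))\big)ds$$ for all $\tau\in(0,t_{k+1}-t_k]$, $k\in\mathbb{N}_0$ (integral in $X_{-1}$). Periodic event-triggering mechanism with sampling period $h>0$, threshold $\varepsilon\ge0$ and $\ell_{\max}\in\mathbb{N}$: $t_0:=0$, $t_{k+1}:=\min\{t_k+\ell_{\max}h,\bar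 t_{k+1}\}$, where $$\bar t_{k+1}:=\min\{\ell h>t_k:\|x(\ell h)-x(t_k)\|>\varepsilon\|x(t_k)\|,\ \ell\in\mathbb{N}\},\quad k\in\mathbb{N}_0$$ (with $\min\emptyset=\infty$). The times and the solution are generated recursively: in the definition of $\bar t_{k+1}$, $x(\ell h)$ for $\ell h>t_k$ is the value of the trajectory obtained by keeping the input $u=Fx(t_k)$ after $t_k$. Exponential stability of the closed-loop system: there exist constants $\Gamma_0\ge1$, $\gamma_0>0$ such that the solution satisfies $\|x(t)\|\le\Gamma_0e^{-\gamma_0t}\|x^0\|$ for all $x^0\in X$ and all $t\ge0$. *)

(* Defs.v *)
From Stdlib Require Import Reals Lra List.
From Coquelicot Require Import Coquelicot.
Open Scope R_scope.

(** Banach spaces are complex: [CompleteNormedModule C_AbsRing].  A bounded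
    linear operator is a map satisfying Coquelicot's [is_linear], which includes
    the bound [norm (l x) <= M * norm x]. *)

(** Coquelicot's Riemann integral [is_RInt] lives in real normed modules, so a
    complex Banach space is turned into a real one, with the same group,
    topology and norm, by restricting the scalars along [RtoC]. *)
Section RestrictScalars.

Context (V : CompleteNormedModule C_AbsRing).

Definition real_scal (r : R) (v : V) : V := scal (RtoC r) v.

Lemma real_scal_assoc (x y : R_Ring) (u : V) :
  real_scal x (real_scal y u) = real_scal (mult x y) u.
Proof.
  unfold real_scal. rewrite scal_assoc. f_equal.
  symmetry. apply RtoC_mult.
Qed.

Lemma real_scal_one (u : V) : real_scal (one : R_Ring) u = u.
Proof. apply (scal_one u). Qed.

Lemma real_scal_distr_l (x : R_Ring) (u v : V) :
  real_scal x (plus u v) = plus (real_scal x u) (real_scal x v).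
Proof. apply (scal_distr_l (RtoC x) u v). Qed.

Lemma real_scal_distr_r (x y : R_Ring) (u : V) :
  real_scal (plus x y) u = plus (real_scal x u) (real_scal y u).
Proof.
  transitivity (scal (plus (RtoC x) (RtoC y) : C_Ring) u).
  - unfold real_scal. f_equal. apply RtoC_plus.
  - apply (scal_distr_r (RtoC x : C_Ring) (RtoC y) u).
Qed.

Definition real_ModuleSpace_mixin :=
  ModuleSpace.Mixin R_Ring V real_scal real_scal_assoc real_scal_one
    real_scal_distr_l real_scal_distr_r.

Definition real_ModuleSpace_class : ModuleSpace.class_of R_Ring V :=
  ModuleSpace.Class R_Ring V (AbelianGroup.class V) real_ModuleSpace_mixin.

Definition real_NormedModuleAux_class : NormedModuleAux.class_of R_AbsRing V :=
  NormedModuleAux.Class R_AbsRing V real_ModuleSpace_class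
    (UniformSpace.class V).

Definition real_NormedModuleAux : NormedModuleAux R_AbsRing :=
  NormedModuleAux.Pack R_AbsRing V real_NormedModuleAux_class V.

Lemma real_norm_scal (l : R_AbsRing) (x : V) :
  norm (real_scal l x) <= abs l * norm x.
Proof.
  unfold real_scal.
  replace (abs l) with (@abs C_AbsRing (RtoC l)) by apply Cmod_R.
  apply (@norm_scal C_AbsRing V).
Qed.

Definition real_NormedModule_mixin :
    NormedModule.mixin_of R_AbsRing real_NormedModuleAux :=
  NormedModule.Mixin R_AbsRing real_NormedModuleAux
    (@norm C_AbsRing V) (@norm_factor C_AbsRing V)
    (@norm_triangle C_AbsRing V) real_norm_scal
    (@norm_compat1 C_AbsRing V) (@norm_compat2 C_AbsRing V)
    (@norm_eq_zero C_AbsRing V).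

Definition real_NormedModule_class : NormedModule.class_of R_AbsRing V :=
  NormedModule.Class R_AbsRing V real_NormedModuleAux_class
    real_NormedModule_mixin.

Definition real_restriction : CompleteNormedModule R_AbsRing :=
  CompleteNormedModule.Pack R_AbsRing V
    (CompleteNormedModule.Class R_AbsRing V real_NormedModule_class
      (CompleteSpace.class V)) V.

End RestrictScalars.

Definition is_hilbert (X : CompleteNormedModule C_AbsRing) : Prop :=
  exists ip : X -> X -> C,
    (forall x y z, ip (plus x y) z = Cplus (ip x z) (ip y z)) /\
    (forall (a : C) x y, ip (scal a x) y = Cmult a (ip x y)) /\
    (forall x y, ip y x = Cconj (ip x y)) /\
    (forall x, ip x x = RtoC (norm x ^ 2)).

Section CompactOperators.

Definition closure {T : UniformSpace} (S : T -> Prop) (y : T) : Prop :=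
  forall P : T -> Prop, locally y P -> exists z, S z /\ P z.

Definition compact_set {T : UniformSpace} (K : T -> Prop) : Prop :=
  forall O : (T -> Prop) -> Prop,
    (forall P, O P -> open P) ->
    (forall x, K x -> exists P, O P /\ P x) ->
    exists l : list (T -> Prop),
      (forall P, In P l -> O P) /\
      (forall x, K x -> exists P, In P l /\ P x).

Definition compact_operator {X Y : CompleteNormedModule C_AbsRing}
    (F : X -> Y) : Prop :=
  is_linear F /\
  compact_set (closure (fun y => exists x, norm x <= 1 /\ y = F x)).

End CompactOperators.

(** Unbounded operators are given by their graphs: [A x y] means that [x] lies
    in the domain of [A] and [A x = y].  Semigroups [T : R -> X -> X] are only
    considered at nonnegative times. *)
Section Semigroups.

Context {X : CompleteNormedModule C_AbsRing}.

Definition c0_semigroup (T : R -> X -> X) : Prop :=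
  (forall t, 0 <= t -> is_linear (T t)) /\
  (forall x, T 0 x = x) /\
  (forall t s x, 0 <= t -> 0 <= s -> T (t + s) x = T t (T s x)) /\
  (forall x, filterlim (fun t => T t x) (at_right 0) (locally x)).

Definition generator (T : R -> X -> X) (x y : X) : Prop :=
  filterlim (fun t => scal (RtoC (/ t)) (minus (T t x) x))
    (at_right 0) (locally y).

Definition generates (A : X -> X -> Prop) (T : R -> X -> X) : Prop :=
  c0_semigroup T /\ (forall x y, A x y <-> generator T x y).

Definition exp_stable_semigroup (V : R -> X -> X) : Prop :=
  exists Gamma gamma : R, 1 <= Gamma /\ 0 < gamma /\
    forall t, 0 <= t -> forall x,
      norm (V t x) <= Gamma * exp (- gamma * t) * norm x.

(** The open sector [z <> 0], [|arg z| < delta], for [0 < delta <= PI / 2]. *)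
Definition sector (delta : R) (z : C) : Prop := Cmod z * cos delta < Re z.

(** Complex differentiability at [z] of an operator-valued map, in the operator
    norm; [D] is the derivative. *)
Definition op_differentiable (S : C -> X -> X) (z : C) : Prop :=
  exists D : X -> X, is_linear D /\
    forall eps, 0 < eps ->
      locally z (fun w => forall x,
        norm (minus (minus (S w x) (S z x)) (scal (Cminus w z) (D x)))
          <= eps * Cmod (Cminus w z) * norm x).

Definition analytic_semigroup (T : R -> X -> X) : Prop :=
  c0_semigroup T /\
  exists (delta : R) (S : C -> X -> X),
    0 < delta <= PI / 2 /\
    (forall z, sector delta z -> is_linear (S z)) /\
    (forall t x, 0 < t -> S (RtoC t) x = T t x) /\
    (forall z w x, sector delta z -> sector delta w ->
       S (Cplus z w) x = S z (S w x)) /\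
    (forall z, sector delta z -> op_differentiable S z) /\
    (forall delta' x, 0 < delta' < delta ->
       filterlim (fun z => S z x)
         (within (sector delta') (locally (RtoC 0))) (locally x)).

(** [lambda] is in the resolvent set of [A], and [Rl = (lambda I - A)^{-1}]. *)
Definition is_resolvent (A : X -> X -> Prop) (lambda : C) (Rl : X -> X) : Prop :=
  is_linear Rl /\
  (forall y, exists w, A (Rl y) w /\ minus (scal lambda (Rl y)) w = y) /\
  (forall x w, A x w -> Rl (minus (scal lambda x) w) = x).

End Semigroups.

Section Extrapolation.

Context {X Xm1 : CompleteNormedModule C_AbsRing}.

(** [Xm1] together with the embedding [j] is a completion of [X] for the norm
    [norm (Rl x)]. *)
Definition is_extrapolation_space (Rl : X -> X) (j : X -> Xm1) : Prop :=
  is_linear j /\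
  (forall x, norm (j x) = norm (Rl x)) /\
  (forall (z : Xm1) (eps : R), 0 < eps -> exists x, norm (minus (j x) z) < eps).

Definition is_extended_semigroup (j : X -> Xm1) (T : R -> X -> X)
    (Tm1 : R -> Xm1 -> Xm1) : Prop :=
  c0_semigroup Tm1 /\ (forall t x, 0 <= t -> Tm1 t (j x) = j (T t x)).

End Extrapolation.

Section ClosedLoop.

Context {X U Xm1 : CompleteNormedModule C_AbsRing}.
Variables (j : X -> Xm1) (T : R -> X -> X) (Tm1 : R -> Xm1 -> Xm1).
Variables (B : U -> Xm1) (F : X -> U).

(** The part in [X] of [A + B F], with [A] extended to [Xm1] as the generator of
    the extended semigroup. *)
Definition A_BF (x y : X) : Prop :=
  exists z : Xm1, generator Tm1 (j x) z /\ plus z (B (F x)) = j y.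

(** Variation of constants at time [tau] along the trajectory [z], with the
    input held at [F xi], where [xi] is the initial state. *)
Definition hold_equation (phi : X -> X) (xi : X) (z : R -> X) (tau : R) : Prop :=
  exists I : Xm1,
    @is_RInt (real_restriction Xm1)
      (fun s => Tm1 (tau - s) (plus (B (F xi)) (j (phi (z s))))) 0 tau I /\
    j (z tau) = plus (j (T tau xi)) I.

Definition mild_solution (phi : X -> X) (t : nat -> R) (x0 : X) (x : R -> X)
    : Prop :=
  continuous_on (fun s => 0 <= s) x /\
  x 0 = x0 /\
  forall (k : nat) (tau : R), 0 < tau <= t (S k) - t k ->
    hold_equation phi (x (t k)) (fun s => x (t k + s)) tau.

(** The trajectory, with time shifted to start at [0], obtained from the state
    [xi] by keeping the input [F xi] forever. *)
Definition held_trajectory (phi : X -> X) (xi : X) (z : R -> X) : Prop :=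
  continuous_on (fun s => 0 <= s) z /\
  z 0 = xi /\
  forall tau, 0 < tau -> hold_equation phi xi z tau.

(** [m = min E], with [min] of the empty set equal to [+oo]. *)
Definition is_min (E : R -> Prop) (m : Rbar) : Prop :=
  match m with
  | Finite r => E r /\ forall s, E s -> r <= s
  | p_infty => forall s, ~ E s
  | m_infty => False
  end.

Definition event_times (h eps tk : R) (z : R -> X) (s : R) : Prop :=
  exists l : nat, (1 <= l)%nat /\ s = INR l * h /\ tk < s /\
    norm (minus (z (s - tk)) (z 0)) > eps * norm (z 0).

Definition event_triggered (phi : X -> X) (h eps : R) (lmax : nat)
    (x : R -> X) (t : nat -> R) : Prop :=
  t 0%nat = 0 /\
  forall k : nat, exists (z : R -> X) (tbar : Rbar),
    held_trajectory phi (x (t k)) z /\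
    is_min (event_times h eps (t k) z) tbar /\
    Finite (t (S k)) = Rbar_min (Finite (t k + INR lmax * h)) tbar.

Definition periodic_solution (h : R) (x0 : X) (x : R -> X) : Prop :=
  mild_solution (fun _ => zero) (fun k => INR k * h) x0 x.

Definition event_triggered_solution (phi : X -> X) (h eps : R) (lmax : nat)
    (x0 : X) (x : R -> X) : Prop :=
  exists t : nat -> R,
    event_triggered phi h eps lmax x t /\ mild_solution phi t x0 x.

(** [sol x0 x] says that [x] is a solution with initial state [x0]; that the
    solution exists and is unique on [[0, +oo)] is part of the definition. *)
Definition exp_stable_system (sol : X -> (R -> X) -> Prop) : Prop :=
  exists Gamma0 gamma0 : R, 1 <= Gamma0 /\ 0 < gamma0 /\
    forall x0 : X, exists x : R -> X,
      sol x0 x /\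
      (forall y, sol x0 y -> forall t, 0 <= t -> y t = x t) /\
      (forall t, 0 <= t -> norm (x t) <= Gamma0 * exp (- gamma0 * t) * norm x0).

End ClosedLoop.

(* Main.v *)
Require Import Defs.
From Stdlib Require Import Reals Lra Lia Classical IndefiniteDescription ssreflect.
From Coquelicot Require Import Coquelicot.
Open Scope R_scope.

(** Over a sampling interval of length [h], a held input acts on the state through
    two bounded maps: the semigroup [T h], and the hold response [G _ h], where
    [j (G xi t)] is the integral of [Tm1 s (B (F xi))] over [[0, t]].  The operator
    [B] takes values in the larger space, but the periodic sampled-data system has
    [X]-valued solutions that decay: these solutions are [T t xi + G xi t] on the
    first interval, so [G xi t] lies in [X] and is bounded by a multiple of
    [norm xi] there, and at the sampling times they are the iterates of
    [D y = T h y + G y h], so the powers of [D] decay geometrically.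

    For the event-triggered loop let [y n] be the state at time [n * h] and [xi]
    the state whose feedback is being held.  Restarting the variation of constants
    formula at [n * h] gives
      [y (n + 1) = D (y n) + G (xi - y n) h + (integral of T (h - s) phi (x (n h + s)))].
    As no event has occurred since the last update, [norm (y n - xi)] is at most
    [eps * norm xi], and for [eps <= 1/2] this makes [norm xi <= 2 * norm (y n)].
    Hence the second term is at most a multiple of [eps * norm (y n)]; a Gronwall
    bound makes the third at most a multiple of [L * norm (y n)].  So the sampled
    loop is a small perturbation of a power-stable linear recursion and still decays
    geometrically, at a rate independent of when the updates happen
    ([held_trajectory_step], [perturbed_power_stable]); the Gronwall bound
    [held_trajectory_growth] controls the state between the samples.

    The rest of the work is well-posedness.  Held trajectories solve a Volterra
    equation with Lipschitz nonlinearity, so they exist and are unique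
    ([volterra_exists], [volterra_unique], [hold_equation_iff]).  All update times
    are multiples of [h] and grow by at least [h] ([next_update_spec]), so the
    trajectories can be concatenated to a solution on the half-line, and two
    solutions agree interval after interval ([event_triggered_solution_exists],
    [event_triggered_solution_unique]).  Local boundedness of a strongly continuous
    semigroup, needed in every estimate, comes from the uniform boundedness
    principle. *)

(** * Exponentials, powers and finite families of reals *)

Lemma exp_monotone (x y : R) : x <= y -> exp x <= exp y.
Proof.
  intros [H|<-]; [now apply Rlt_le, exp_increasing|apply Rle_refl].
Qed.

Lemma exp_pow (x : R) (n : nat) : exp x ^ n = exp (INR n * x).
Proof.
  induction n as [|n IH].
  - simpl. now rewrite Rmult_0_l exp_0.
  - rewrite S_INR Rmult_plus_distr_r Rmult_1_l exp_plus -IH. simpl. ring.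
Qed.

Lemma div_pow2_small (C eps : R) : 0 <= C -> 0 < eps -> exists n, C / 2 ^ n < eps.
Proof.
  intros HC He.
  destruct (pow_lt_1_zero (/ 2) ltac:(rewrite Rabs_pos_eq; lra) (eps / (C + 1)))
    as [n Hn].
  { apply Rdiv_lt_0_compat; lra. }
  exists n. specialize (Hn n (Nat.le_refl n)).
  rewrite pow_inv Rabs_pos_eq in Hn; [|apply Rlt_le, Rinv_0_lt_compat, pow_lt; lra].
  apply Rmult_lt_compat_r with (r := C + 1) in Hn; [|lra].
  unfold Rdiv in Hn at 1. rewrite Rmult_assoc Rinv_l ?Rmult_1_r in Hn; [|lra].
  assert (0 < / 2 ^ n) by (apply Rinv_0_lt_compat, pow_lt; lra).
  unfold Rdiv. nra.
Qed.

Lemma le_div_pow2_zero (a C : R) : 0 <= C -> (forall n, a <= C / 2 ^ n) -> a <= 0.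
Proof.
  intros HC H. apply le_epsilon. intros eps He.
  destruct (div_pow2_small C eps HC He) as [n Hn]. specialize (H n). lra.
Qed.

Lemma finitely_many_bounded (u : nat -> R) (N : nat) :
  exists C, forall n, (n < N)%nat -> u n <= C.
Proof.
  induction N as [|N [C HC]]; [exists 0; intros; lia|].
  exists (Rmax C (u N)). intros n Hn.
  destruct (Nat.eq_dec n N) as [->|Hne]; [apply Rmax_r|].
  eapply Rle_trans; [apply HC; lia|apply Rmax_l].
Qed.

(** * Normed spaces *)

Lemma minus_plus_plus {G : AbelianGroup} (a b c d : G) :
  minus (plus a b) (plus c d) = plus (minus a c) (minus b d).
Proof.
  unfold minus. rewrite opp_plus -!plus_assoc. f_equal.
  rewrite !plus_assoc. f_equal. apply plus_comm.
Qed.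

Lemma minus_plus_l {G : AbelianGroup} (a b c : G) : minus (plus a b) (plus a c) = minus b c.
Proof. now rewrite minus_plus_plus minus_eq_zero plus_zero_l. Qed.

Lemma plus_minus_cancel {G : AbelianGroup} (a b : G) : plus b (minus a b) = a.
Proof.
  unfold minus. rewrite plus_comm -plus_assoc plus_opp_l. apply plus_zero_r.
Qed.

Lemma minus_plus_cancel {G : AbelianGroup} (a b : G) : minus (plus a b) a = b.
Proof.
  unfold minus. rewrite (plus_comm a) -plus_assoc plus_opp_r. apply plus_zero_r.
Qed.

Lemma minus_zero_eq {G : AbelianGroup} (a b : G) : minus a b = zero -> a = b.
Proof. intros H. rewrite -(plus_minus_cancel a b) H. apply plus_zero_r. Qed.

Lemma plus_swap_r {G : AbelianGroup} (a b c : G) :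
  plus (plus a b) c = plus (plus a c) b.
Proof. rewrite -!plus_assoc. f_equal. apply plus_comm. Qed.

Section NormedSpace.

Context {V : CompleteNormedModule C_AbsRing}.

Lemma norm_minus_sym (a b : V) : norm (minus a b) = norm (minus b a).
Proof. now rewrite -norm_opp opp_minus. Qed.

Lemma norm_minus_le (a b : V) : norm (minus a b) <= norm a + norm b.
Proof. rewrite -(norm_opp b). exact (norm_triangle a (opp b)). Qed.

Lemma norm_minus_triangle (b a c : V) :
  norm (minus a c) <= norm (minus a b) + norm (minus b c).
Proof. rewrite (minus_trans b). exact (norm_triangle (minus a b) (minus b c)). Qed.

Lemma norm_le_norm_minus (b a : V) : norm a <= norm b + norm (minus a b).
Proof.
  rewrite -{1}(plus_minus_cancel a b). exact (norm_triangle b (minus a b)).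
Qed.

Lemma norm_minus_zero_eq (a b : V) : norm (minus a b) <= 0 -> a = b.
Proof.
  intros H. apply minus_zero_eq. apply: norm_eq_zero.
  apply Rle_antisym; [exact H|apply norm_ge_0].
Qed.

Lemma norm_scal_RtoC (r : R) (x : V) :
  0 < r -> norm (scal (RtoC r) x) = r * norm x.
Proof.
  intros Hr.
  assert (Hle : forall (s : R) (y : V), 0 < s -> norm (scal (RtoC s) y) <= s * norm y).
  { intros s y Hs. eapply Rle_trans; [apply (@norm_scal C_AbsRing V)|].
    apply Req_le. f_equal. change (Cmod (RtoC s) = s).
    rewrite Cmod_R. apply Rabs_pos_eq; lra. }
  apply Rle_antisym; [now apply Hle|].
  replace (norm x) with (norm (scal (RtoC (/ r)) (scal (RtoC r) x))).
  - eapply Rle_trans.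
    + apply Rmult_le_compat_l; [lra|]. apply Hle. now apply Rinv_0_lt_compat.
    + apply Req_le. field. lra.
  - f_equal. rewrite scal_assoc.
    transitivity (scal (one : C_Ring) x); [f_equal|apply (scal_one x)].
    change (Cmult (RtoC (/ r)) (RtoC r) = RtoC 1).
    rewrite -RtoC_mult. f_equal. field. lra.
Qed.

Lemma filterlim_norm_iff {T : Type} (Fl : (T -> Prop) -> Prop) {FF : Filter Fl}
    (f : T -> V) (l : V) :
  filterlim f Fl (locally l) <->
  (forall eps, 0 < eps -> Fl (fun x => norm (minus (f x) l) < eps)).
Proof.
  rewrite filterlim_locally_ball_norm. split.
  - intros H eps He. exact (H (mkposreal eps He)).
  - intros H eps. apply H, cond_pos.
Qed.

Lemma continuous_norm_iff (f : R -> V) (t : R) :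
  continuous f t <->
  (forall eps, 0 < eps -> exists d, 0 < d /\
     forall s, Rabs (s - t) < d -> norm (minus (f s) (f t)) < eps).
Proof.
  unfold continuous. rewrite filterlim_norm_iff. split; intros H eps He.
  - destruct (H eps He) as [d Hd]. exists d. split; [apply cond_pos|].
    intros s Hs. now apply Hd.
  - destruct (H eps He) as (d & Hd & Hs). exists (mkposreal d Hd).
    intros s Hb. now apply Hs.
Qed.

(** Trajectories matter at nonnegative times only, but the integrals below are simplest
    for functions continuous on the whole line; freezing a function at [0] to the left
    turns one setting into the other. *)
Lemma continuous_on_nonneg (f : R -> V) :
  continuous_on (fun s => 0 <= s) f <->
  (forall t, continuous (fun s => f (Rmax 0 s)) t).
Proof.
  split.
  - intros H t. apply continuous_norm_iff. intros eps He.
    assert (Ht : 0 <= Rmax 0 t) by apply Rmax_l.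
    specialize (H _ Ht). rewrite filterlim_norm_iff in H.
    destruct (H eps He) as [d Hd]. exists d. split; [apply cond_pos|].
    intros s Hs. apply Hd; [|apply Rmax_l].
    change (Rabs (Rmax 0 s - Rmax 0 t) < d).
    revert Hs. unfold Rmax, Rabs. repeat destruct Rle_dec; repeat destruct Rcase_abs; lra.
  - intros H t Ht. specialize (H t).
    assert (E : forall s, 0 <= s -> Rmax 0 s = s) by (intros; now apply Rmax_right).
    apply filterlim_norm_iff. { apply within_filter, locally_filter. }
    intros eps He. rewrite continuous_norm_iff in H.
    destruct (H eps He) as (d & Hd & Hs). exists (mkposreal d Hd).
    intros s Hb Hs0. specialize (Hs s Hb). now rewrite !E in Hs.
Qed.

Lemma continuous_clamp (z : R -> V) :
  (forall s, continuous z s) -> forall s, continuous (fun s => z (Rmax 0 s)) s.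
Proof.
  intros Hz s. apply continuous_norm_iff. intros eps He.
  destruct (proj1 (continuous_norm_iff _ _) (Hz (Rmax 0 s)) eps He) as (d & Hd & H).
  exists d. split; [exact Hd|]. intros r Hr. apply H. revert Hr.
  unfold Rmax, Rabs. repeat destruct Rle_dec; repeat destruct Rcase_abs; lra.
Qed.

(** Both completeness arguments of this file have this shape: the balls of a Baire
    construction, and the tails of a geometrically converging iteration. *)
Lemma nested_balls (x : nat -> V) (r : nat -> R) :
  (forall n, norm (minus (x (S n)) (x n)) + r (S n) <= r n) ->
  (forall n, 0 <= r n) ->
  (forall eps, 0 < eps -> exists n, r n < eps) ->
  exists l, forall n, norm (minus l (x n)) <= r n.
Proof.
  intros Hx Hr0 Hr.
  assert (Hk : forall n k, norm (minus (x (n + k)%nat) (x n)) + r (n + k)%nat <= r n).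
  { intros n k. induction k as [|k IH].
    - rewrite Nat.add_0_r minus_eq_zero norm_zero. lra.
    - rewrite Nat.add_succ_r.
      pose proof (norm_minus_triangle (x (n + k)%nat) (x (S (n + k))) (x n)).
      specialize (Hx (n + k)%nat). lra. }
  assert (Hn : forall n m, (n <= m)%nat -> norm (minus (x m) (x n)) <= r n).
  { intros n m Hnm. replace m with (n + (m - n))%nat by lia.
    specialize (Hk n (m - n)%nat). specialize (Hr0 (n + (m - n))%nat). lra. }
  destruct (proj1 (@filterlim_locally_cauchy nat V eventually eventually_filter x))
    as [l Hl].
  { intros eps. destruct (Hr (eps / 2)) as [n H]; [destruct eps; simpl; lra|].
    exists (fun m => (n <= m)%nat). split; [now exists n|].
    intros u v Hu Hv. apply: norm_compat1. change (norm (minus (x v) (x u)) < eps).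
    pose proof (norm_minus_triangle (x n) (x v) (x u)) as Ht.
    rewrite (norm_minus_sym (x n) (x u)) in Ht.
    pose proof (Hn n u Hu). pose proof (Hn n v Hv). lra. }
  exists l. intros n. apply le_epsilon. intros eps He.
  rewrite filterlim_norm_iff in Hl. destruct (Hl eps He) as [N HN].
  pose proof (norm_minus_triangle (x (N + n)%nat) l (x n)) as Ht.
  rewrite (norm_minus_sym l (x (N + n)%nat)) in Ht.
  specialize (HN (N + n)%nat ltac:(lia)). pose proof (Hn n (N + n)%nat ltac:(lia)). lra.
Qed.

End NormedSpace.

(** The norms in this file are those of [CompleteNormedModule]; stating linearity through
    the same structure lets the two rewrite together. *)
Section LinearMaps.

Context {V W : CompleteNormedModule C_AbsRing} (l : V -> W) (Hl : is_linear l).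

Lemma lin_plus (x y : V) : l (plus x y) = plus (l x) (l y).
Proof. exact (linear_plus l Hl x y). Qed.

Lemma lin_minus (x y : V) : l (minus x y) = minus (l x) (l y).
Proof. exact (linear_minus l x y Hl). Qed.

Lemma lin_zero : l zero = zero.
Proof. exact (linear_zero l Hl). Qed.

Lemma lin_scal (k : C) (x : V) : l (scal k x) = scal k (l x).
Proof. exact (linear_scal l Hl k x). Qed.

Lemma lin_bound : exists M, 0 < M /\ forall x : V, norm (l x) <= M * norm x.
Proof. exact (linear_norm l Hl). Qed.

End LinearMaps.

(** Semigroup orbits and convolutions are compared most easily at two ordered times. *)
Lemma continuous_of_uniform {V : CompleteNormedModule C_AbsRing} (p : R -> V) :
  (forall a eps, 0 < eps -> exists d, 0 < d /\ forall s t, 0 <= s <= t -> t <= a ->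
     t - s < d -> norm (minus (p t) (p s)) < eps) ->
  forall t, continuous (fun s => p (Rmax 0 s)) t.
Proof.
  intros Hp t. apply continuous_norm_iff. intros eps He.
  destruct (Hp (Rmax 0 t + 1) eps He) as (d & Hd & Hpd).
  exists (Rmin d 1). split; [apply Rmin_pos; lra|]. intros s Hs.
  assert (Hst : Rabs (Rmax 0 s - Rmax 0 t) < Rmin d 1).
  { revert Hs. generalize (Rmin d 1). intros e.
    unfold Rmax, Rabs. repeat destruct Rle_dec; repeat destruct Rcase_abs; lra. }
  pose proof (Rmin_l d 1). pose proof (Rmin_r d 1). apply Rabs_def2 in Hst.
  pose proof (Rmax_l 0 s). pose proof (Rmax_l 0 t).
  destruct (Rle_dec (Rmax 0 s) (Rmax 0 t)).
  - rewrite norm_minus_sym. apply Hpd; lra.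
  - apply Hpd; lra.
Qed.

Lemma continuous_of_increments {V : CompleteNormedModule C_AbsRing} (p q : R -> V) :
  (forall a, exists M, 1 <= M /\ forall s t, 0 <= s <= t -> t <= a ->
     norm (minus (p t) (p s)) <= M * norm (q (t - s))) ->
  (forall eps, 0 < eps -> exists d, 0 < d /\ forall t, 0 <= t < d -> norm (q t) < eps) ->
  forall t, continuous (fun s => p (Rmax 0 s)) t.
Proof.
  intros Hp Hq. apply continuous_of_uniform. intros a eps He.
  destruct (Hp a) as (M & HM1 & HM).
  destruct (Hq (eps / M)) as (d & Hd & Hqd); [apply Rdiv_lt_0_compat; lra|].
  exists d. split; [exact Hd|]. intros s t Hs Ht Hst.
  eapply Rle_lt_trans; [now apply HM|].
  specialize (Hqd (t - s) ltac:(lra)).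
  apply Rmult_lt_compat_l with (r := M) in Hqd; [|lra].
  replace (M * (eps / M)) with eps in Hqd by (field; lra). exact Hqd.
Qed.

Lemma geometric_limit {V : CompleteNormedModule C_AbsRing} (x : nat -> V) (C : R) :
  0 <= C -> (forall n, norm (minus (x (S n)) (x n)) <= C / 2 ^ n) ->
  exists l, forall n, norm (minus l (x n)) <= 2 * C / 2 ^ n.
Proof.
  intros HC Hx.
  assert (Hp : forall n, 0 < 2 ^ n) by (intros n; apply pow_lt; lra).
  apply nested_balls.
  - intros n. specialize (Hx n). specialize (Hp n).
    replace (2 * C / 2 ^ S n) with (C / 2 ^ n) by (simpl; field; lra).
    replace (2 * C / 2 ^ n) with (C / 2 ^ n + C / 2 ^ n) by (field; lra). lra.
  - intros n. apply Rmult_le_pos; [lra|]. now apply Rlt_le, Rinv_0_lt_compat.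
  - intros eps He. apply div_pow2_small; lra.
Qed.

(** * Uniform boundedness principle *)

(** If no uniform bound exists, then every ball contains a smaller ball on which some
    [S n] exceeds any prescribed [k]; a point common to a nested sequence of such balls,
    for all [k], contradicts pointwise boundedness. *)
Lemma uniform_boundedness {V W : CompleteNormedModule C_AbsRing} (S : nat -> V -> W) :
  (forall n, is_linear (S n)) ->
  (forall x, exists C, forall n, norm (S n x) <= C) ->
  exists M, forall n x, norm (S n x) <= M * norm x.
Proof.
  intros Hlin Hpt. apply NNPP. intros Hno.
  assert (Hbig : forall K r, 0 <= K -> 0 < r ->
    exists n v, norm v <= r /\ K < norm (S n v)).
  { intros K r HK Hr. apply NNPP. intros Hk. apply Hno. exists (K / r).
    intros n x. apply Rnot_lt_le. intros Hx. apply Hk.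
    assert (Hnx : 0 < norm x).
    { destruct (Rle_lt_or_eq_dec 0 (norm x) (norm_ge_0 x)) as [H|H]; [exact H|].
      exfalso. apply eq_sym, norm_eq_zero in H. subst x.
      rewrite (lin_zero (S n) (Hlin n)) !norm_zero in Hx. lra. }
    exists n, (scal (RtoC (r / norm x)) x).
    assert (0 < r / norm x) by (now apply Rdiv_lt_0_compat).
    rewrite (lin_scal (S n) (Hlin n)) !norm_scal_RtoC //.
    split; [apply Req_le; field; lra|].
    apply Rmult_lt_compat_l with (r := r / norm x) in Hx; [|assumption].
    replace (r / norm x * (K / r * norm x)) with K in Hx by (field; lra). exact Hx. }
  assert (Hstep : forall (k : nat) (p : V * {r : R | 0 < r}),
    exists q : V * {r : R | 0 < r},
      norm (minus (fst q) (fst p)) <= proj1_sig (snd p) / 2 /\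
      proj1_sig (snd q) <= proj1_sig (snd p) / 2 /\
      exists n, forall y, norm (minus y (fst q)) <= proj1_sig (snd q) ->
        INR k <= norm (S n y)).
  { intros k [x [r Hr]]. simpl.
    destruct (Hbig (INR k + 1) (r / 2)) as (n & v & Hv & Hn);
      [pose proof (pos_INR k); lra|lra|].
    destruct (lin_bound (S n) (Hlin n)) as (M & HM & HMn).
    (* [2 S v = S (x + v) - S (x - v)], so one of [x + v], [x - v] has an image at
       least as large as that of [v]. *)
    assert (Hw : exists w, norm (minus w x) <= r / 2 /\ INR k + 1 < norm (S n w)).
    { apply NNPP. intros Hw.
      assert (H1 : norm (S n (plus x v)) <= INR k + 1).
      { apply Rnot_lt_le. intros H. apply Hw. exists (plus x v). split; [|exact H].
        now rewrite minus_plus_cancel. }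
      assert (H2 : norm (S n (minus x v)) <= INR k + 1).
      { apply Rnot_lt_le. intros H. apply Hw. exists (minus x v). split; [|exact H].
        unfold minus at 2. now rewrite minus_plus_cancel norm_opp. }
      assert (H3 : scal (RtoC 2) (S n v) = minus (S n (plus x v)) (S n (minus x v))).
      { rewrite -(lin_minus (S n) (Hlin n)) -(lin_scal (S n) (Hlin n)).
        f_equal. unfold minus at 2. rewrite minus_plus_l.
        unfold minus. rewrite opp_opp.
        replace (RtoC 2) with (plus (one : C_Ring) one)
          by (change (Cplus (RtoC 1) (RtoC 1) = RtoC 2); now rewrite -RtoC_plus).
        rewrite (scal_distr_r (one : C_Ring) one v).
        now rewrite (scal_one v). }
      pose proof (norm_minus_le (S n (plus x v)) (S n (minus x v))) as H4.
      rewrite -H3 norm_scal_RtoC in H4; lra. }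
    destruct Hw as (w & Hwx & Hwn).
    assert (Hr' : 0 < Rmin (r / 2) (/ M)).
    { apply Rmin_pos; [lra|now apply Rinv_0_lt_compat]. }
    exists (w, exist _ _ Hr'). simpl. split; [exact Hwx|].
    split; [apply Rmin_l|]. exists n. intros y Hy.
    pose proof (norm_le_norm_minus (S n y) (S n w)) as Ht.
    rewrite -(lin_minus (S n) (Hlin n)) in Ht.
    pose proof (HMn (minus w y)) as Hm. rewrite (norm_minus_sym w y) in Hm.
    assert (M * norm (minus y w) <= 1).
    { apply Rle_trans with (M * / M); [|apply Req_le; field; lra].
      apply Rmult_le_compat_l; [lra|]. eapply Rle_trans; [exact Hy|apply Rmin_r]. }
    lra. }
  pose (next := fun k p => proj1_sig (constructive_indefinite_description _ (Hstep k p))).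
  pose (p := fix p k := match k with
    | O => (zero, exist _ 1 Rlt_0_1)
    | Datatypes.S k' => next k' (p k') end).
  assert (Hp : forall k,
      norm (minus (fst (p (Datatypes.S k))) (fst (p k))) <= proj1_sig (snd (p k)) / 2 /\
      proj1_sig (snd (p (Datatypes.S k))) <= proj1_sig (snd (p k)) / 2 /\
      exists n, forall y,
        norm (minus y (fst (p (Datatypes.S k)))) <= proj1_sig (snd (p (Datatypes.S k))) ->
        INR k <= norm (S n y)).
  { intros k. exact (proj2_sig (constructive_indefinite_description _ (Hstep k (p k)))). }
  destruct (nested_balls (fun k => fst (p k)) (fun k => proj1_sig (snd (p k)))) as [l Hl].
  - intros k. destruct (Hp k) as (H1 & H2 & _). lra.
  - intros k. apply Rlt_le, proj2_sig.
  - intros eps He. destruct (div_pow2_small 1 eps Rle_0_1 He) as [n Hn].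
    exists n. eapply Rle_lt_trans; [|exact Hn].
    clear -Hp. induction n as [|n IH]; [simpl; lra|].
    destruct (Hp n) as (_ & H2 & _).
    replace (1 / 2 ^ Datatypes.S n) with (1 / 2 ^ n / 2)
      by (simpl; field; apply pow_nonzero; lra). lra.
  - destruct (Hpt l) as [C HC].
    destruct (nfloor_ex (Rmax 0 C) (Rmax_l _ _)) as [k [_ Hk]].
    destruct (Hp (Datatypes.S k)) as (_ & _ & n & Hn).
    specialize (Hn l (Hl _)). specialize (HC n). rewrite S_INR in Hn.
    pose proof (Rmax_r 0 C). lra.
Qed.

(** * Strongly continuous semigroups *)

Section Semigroup.

Context {V : CompleteNormedModule C_AbsRing} (T : R -> V -> V).
Hypothesis HT : c0_semigroup T.

Lemma sg_linear t : 0 <= t -> is_linear (T t).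
Proof. exact (proj1 HT t). Qed.

Lemma sg_zero x : T 0 x = x.
Proof. exact (proj1 (proj2 HT) x). Qed.

Lemma sg_add t s x : 0 <= t -> 0 <= s -> T (t + s) x = T t (T s x).
Proof. exact (proj1 (proj2 (proj2 HT)) t s x). Qed.

Lemma sg_near_zero x eps : 0 < eps ->
  exists d, 0 < d /\ forall t, 0 <= t < d -> norm (minus (T t x) x) < eps.
Proof.
  intros He. pose proof (proj2 (proj2 (proj2 HT)) x) as H.
  rewrite filterlim_norm_iff in H. destruct (H eps He) as [d Hd].
  exists d. split; [apply cond_pos|]. intros t [[Ht|<-] Htd].
  - apply Hd; [|exact Ht]. change (Rabs (t - 0) < d). rewrite Rabs_pos_eq; lra.
  - now rewrite sg_zero minus_eq_zero norm_zero.
Qed.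

(** Were the semigroup unbounded on every interval [[0, 1 / (n + 1)]], it would be
    unbounded along times tending to [0], where its orbits converge. *)
Lemma sg_bounded_near_zero :
  exists d M, 0 < d /\ 1 <= M /\
    forall t x, 0 <= t <= d -> norm (T t x) <= M * norm x.
Proof.
  apply NNPP. intros Hno.
  assert (H : forall n, exists p : R * V, 0 <= fst p <= / (INR n + 1) /\
    (INR n + 1) * norm (snd p) < norm (T (fst p) (snd p))).
  { intros n. apply NNPP. intros Hn. apply Hno.
    pose proof (pos_INR n).
    exists (/ (INR n + 1)), (INR n + 1).
    split; [apply Rinv_0_lt_compat; lra|split; [lra|]].
    intros t x Ht. apply Rnot_lt_le. intros Hx. apply Hn. now exists (t, x). }
  apply functional_choice in H. destruct H as [p Hp].
  destruct (uniform_boundedness (fun n => T (fst (p n)))) as [M HM].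
  - intros n. apply sg_linear, Hp.
  - intros x. destruct (sg_near_zero x 1 Rlt_0_1) as (d & Hd & Hx).
    destruct (nfloor_ex (/ d)) as [N [_ HN]]; [now apply Rlt_le, Rinv_0_lt_compat|].
    destruct (finitely_many_bounded (fun n => norm (T (fst (p n)) x)) N) as [C HC].
    exists (Rmax C (norm x + 1)). intros n.
    destruct (Nat.le_gt_cases N n) as [Hn|Hn].
    + eapply Rle_trans; [|apply Rmax_r].
      pose proof (norm_le_norm_minus x (T (fst (p n)) x)).
      destruct (Hp n) as [[H0 H1] _].
      assert (Hd' : fst (p n) < d).
      { eapply Rle_lt_trans; [exact H1|]. rewrite -(Rinv_inv d).
        assert (0 < / d) by now apply Rinv_0_lt_compat.
        apply le_INR in Hn. apply Rinv_lt_contravar; [apply Rmult_lt_0_compat|]; lra. }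
      specialize (Hx _ (conj H0 Hd')). lra.
    + eapply Rle_trans; [now apply HC|apply Rmax_l].
  - destruct (nfloor_ex (Rmax 0 M) (Rmax_l _ _)) as [n [_ Hn]].
    destruct (Hp n) as [_ Hn']. specialize (HM n (snd (p n))).
    pose proof (Rmax_r 0 M). pose proof (norm_ge_0 (snd (p n))).
    assert (M * norm (snd (p n)) <= (INR n + 1) * norm (snd (p n)))
      by (apply Rmult_le_compat_r; lra). lra.
Qed.

Lemma sg_bounded a :
  exists M, 1 <= M /\ forall t x, 0 <= t <= a -> norm (T t x) <= M * norm x.
Proof.
  destruct sg_bounded_near_zero as (d & M & Hd & HM & HTd).
  assert (Hn : forall n t x, 0 <= t <= INR n * d -> norm (T t x) <= M ^ n * norm x).
  { induction n as [|n IH]; intros t x Ht.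
    - simpl in *. replace t with 0 by lra. rewrite sg_zero. lra.
    - rewrite S_INR in Ht. pose proof (pow_R1_Rle M n HM). pose proof (norm_ge_0 x).
      destruct (Rle_dec t d) as [Htd|Htd].
      + eapply Rle_trans; [apply HTd; lra|]. simpl.
        apply Rmult_le_compat_r; [lra|nra].
      + replace t with (d + (t - d)) by ring. rewrite sg_add; [|lra|lra].
        eapply Rle_trans; [apply HTd; lra|]. simpl. rewrite Rmult_assoc.
        apply Rmult_le_compat_l; [lra|]. apply IH. lra. }
  destruct (nfloor_ex (Rmax 0 a / d)) as [n [_ Hna]].
  { apply Rmult_le_pos; [apply Rmax_l|now apply Rlt_le, Rinv_0_lt_compat]. }
  exists (M ^ S n). split; [now apply pow_R1_Rle|].
  intros t x Ht. apply Hn. split; [lra|]. rewrite S_INR.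
  apply Rmult_lt_compat_r with (r := d) in Hna; [|exact Hd].
  replace (Rmax 0 a / d * d) with (Rmax 0 a) in Hna by (field; lra).
  pose proof (Rmax_r 0 a). lra.
Qed.

Lemma sg_continuous x t : continuous (fun s => T (Rmax 0 s) x) t.
Proof.
  apply (continuous_of_increments (fun s => T s x) (fun s => minus (T s x) x)).
  - intros a. destruct (sg_bounded a) as (M & HM1 & HM). exists M.
    split; [exact HM1|]. intros s r Hsr Hr.
    replace r with (s + (r - s)) at 1 by ring.
    rewrite sg_add; [|lra|lra].
    rewrite -(lin_minus (T s)); [|apply sg_linear; lra]. apply HM. lra.
  - apply sg_near_zero.
Qed.

Lemma sg_continuous_along (f : R -> V) :
  (forall s, continuous f s) ->
  forall t, continuous (fun s => T (Rmax 0 s) (f s)) t.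
Proof.
  intros Hf t. apply continuous_norm_iff. intros eps He.
  destruct (sg_bounded (Rmax 0 t + 1)) as (M & HM & HTM).
  destruct (proj1 (continuous_norm_iff _ _) (Hf t) (eps / (2 * M))) as (d1 & Hd1 & H1).
  { apply Rdiv_lt_0_compat; lra. }
  destruct (proj1 (continuous_norm_iff _ _) (sg_continuous (f t) t) (eps / 2))
    as (d2 & Hd2 & H2); [lra|].
  exists (Rmin 1 (Rmin d1 d2)). split; [repeat apply Rmin_pos; lra|]. intros s Hs.
  assert (Hs1 : Rabs (s - t) < 1) by (eapply Rlt_le_trans; [exact Hs|apply Rmin_l]).
  assert (Hs2 : Rabs (s - t) < Rmin d1 d2) by (eapply Rlt_le_trans; [exact Hs|apply Rmin_r]).
  specialize (H1 s (Rlt_le_trans _ _ _ Hs2 (Rmin_l _ _))).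
  specialize (H2 s (Rlt_le_trans _ _ _ Hs2 (Rmin_r _ _))).
  pose proof (norm_minus_triangle (T (Rmax 0 s) (f t)) (T (Rmax 0 s) (f s))
    (T (Rmax 0 t) (f t))) as Ht.
  assert (Hmax : 0 <= Rmax 0 s <= Rmax 0 t + 1).
  { apply Rabs_def2 in Hs1. split; [apply Rmax_l|].
    unfold Rmax. repeat destruct Rle_dec; lra. }
  rewrite -(lin_minus (T (Rmax 0 s))) in Ht; [|apply sg_linear; lra].
  pose proof (HTM _ (minus (f s) (f t)) Hmax) as H3.
  assert (M * norm (minus (f s) (f t)) < eps / 2).
  { apply Rmult_lt_compat_l with (r := M) in H1; [|lra].
    replace (M * (eps / (2 * M))) with (eps / 2) in H1 by (field; lra). exact H1. }
  lra.
Qed.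

End Semigroup.

(** * Integrals of continuous functions *)

(** Bounded linear maps carry Riemann sums to Riemann sums. *)
Lemma is_RInt_linear {V W : NormedModule R_AbsRing} (l : V -> W) (Hl : is_linear l)
    (f : R -> V) (a b : R) (I : V) :
  is_RInt f a b I -> is_RInt (fun s => l (f s)) a b (l I).
Proof.
  intros H. unfold is_RInt.
  apply filterlim_ext with
    (fun ptd => l (scal (sign (b - a)) (Riemann_sum f ptd))).
  - intros ptd. rewrite (linear_scal l Hl). f_equal.
    apply (SF_cons_ind (fun p => l (Riemann_sum f p) = Riemann_sum (fun s => l (f s)) p)).
    + intros x. exact (linear_zero l Hl).
    + intros p s IH. rewrite !Riemann_sum_cons (linear_plus l Hl) (linear_scal l Hl).
      now rewrite IH.
  - eapply filterlim_comp; [exact H|]. apply (linear_cont l I Hl).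
Qed.

Lemma continuous_bounded {V : CompleteNormedModule C_AbsRing} (f : R -> V) (a : R) :
  (forall s, continuous f s) ->
  exists C, 0 <= C /\ forall s, 0 <= s <= a -> norm (f s) <= C.
Proof.
  intros Hf. destruct (Rle_dec 0 a) as [Ha|Ha].
  - destruct (continuity_ab_maj (fun s => norm (f s)) 0 a Ha) as (m & Hm & _).
    + intros c _. apply continuity_pt_filterlim.
      apply (filterlim_comp _ _ _ f norm _ (locally (f c))); [apply Hf|].
      exact (filterlim_norm (f c)).
    + exists (norm (f m)). split; [apply norm_ge_0|exact Hm].
  - exists 0. split; [lra|]. intros; lra.
Qed.

Lemma continuous_reflect {V : CompleteNormedModule C_AbsRing} (f : R -> V) (t : R) :
  (forall s, continuous f s) -> forall s, continuous (fun r => f (t - r)) s.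
Proof.
  intros Hf s. apply (continuous_comp (fun r => t - r) f); [|apply Hf].
  apply (continuous_minus (fun _ => t) (fun r => r)); [apply continuous_const|apply continuous_id].
Qed.

Lemma continuous_shift {V : CompleteNormedModule C_AbsRing} (f : R -> V) (c : R) :
  (forall s, continuous f s) -> forall s, continuous (fun r => f (c + r)) s.
Proof.
  intros Hf s. apply (continuous_comp (fun r => c + r) f); [|apply Hf].
  apply (continuous_plus (fun _ => c) (fun r => r)); [apply continuous_const|apply continuous_id].
Qed.

Definition integral {V : CompleteNormedModule C_AbsRing} (f : R -> V) (a b : R) : V :=
  @RInt (real_restriction V) f a b.

Section Integral.

Context {V : CompleteNormedModule C_AbsRing}.

Lemma integral_correct (f : R -> V) (a b : R) :
  (forall s, continuous f s) -> @is_RInt (real_restriction V) f a b (integral f a b).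
Proof.
  intros Hf. apply (@RInt_correct (real_restriction V)).
  apply (@ex_RInt_continuous (real_restriction V)). intros s _. apply Hf.
Qed.

Lemma integral_unique (f : R -> V) (a b : R) (I : V) :
  @is_RInt (real_restriction V) f a b I -> integral f a b = I.
Proof. exact (@is_RInt_unique (real_restriction V) f a b I). Qed.

Lemma integral_norm_le (f : R -> V) (g : R -> R) (a b lg : R) :
  a <= b -> (forall s, continuous f s) ->
  (forall s, a <= s <= b -> norm (f s) <= g s) ->
  is_RInt g a b lg -> norm (integral f a b) <= lg.
Proof.
  intros Hab Hf Hfg Hg.
  exact (@norm_RInt_le (real_restriction V) f g a b _ lg Hab Hfg
    (integral_correct f a b Hf) Hg).
Qed.

Lemma integral_norm_le_const (f : R -> V) (a b C : R) :
  a <= b -> (forall s, continuous f s) ->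
  (forall s, a <= s <= b -> norm (f s) <= C) ->
  norm (integral f a b) <= (b - a) * C.
Proof.
  intros Hab Hf HC.
  exact (@norm_RInt_le_const (real_restriction V) f a b _ C Hab HC
    (integral_correct f a b Hf)).
Qed.

Lemma integral_ext (f g : R -> V) (a b : R) :
  a <= b -> (forall s, a <= s <= b -> f s = g s) -> integral f a b = integral g a b.
Proof.
  intros Hab Hfg. apply (@RInt_ext (real_restriction V)).
  intros s Hs. rewrite Rmin_left // Rmax_right // in Hs. apply Hfg. lra.
Qed.

Lemma integral_plus (f g : R -> V) (a b : R) :
  (forall s, continuous f s) -> (forall s, continuous g s) ->
  integral (fun s => plus (f s) (g s)) a b = plus (integral f a b) (integral g a b).
Proof.
  intros Hf Hg. apply integral_unique.
  exact (@is_RInt_plus (real_restriction V) f g a b _ _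
    (integral_correct f a b Hf) (integral_correct g a b Hg)).
Qed.

Lemma integral_minus (f g : R -> V) (a b : R) :
  (forall s, continuous f s) -> (forall s, continuous g s) ->
  integral (fun s => minus (f s) (g s)) a b = minus (integral f a b) (integral g a b).
Proof.
  intros Hf Hg. apply integral_unique.
  exact (@is_RInt_minus (real_restriction V) f g a b _ _
    (integral_correct f a b Hf) (integral_correct g a b Hg)).
Qed.

Lemma integral_Chasles (f : R -> V) (a b c : R) :
  (forall s, continuous f s) ->
  integral f a c = plus (integral f a b) (integral f b c).
Proof.
  intros Hf. apply integral_unique.
  exact (@is_RInt_Chasles (real_restriction V) f a b c _ _
    (integral_correct f a b Hf) (integral_correct f b c Hf)).
Qed.

Lemma integral_shift (f : R -> V) (a b c : R) :
  (forall s, continuous f s) ->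
  integral f (c + a) (c + b) = integral (fun s => f (c + s)) a b.
Proof.
  intros Hf. symmetry. apply integral_unique.
  pose proof (@is_RInt_comp_lin (real_restriction V) f 1 c a b (integral f (c + a) (c + b)))
    as H.
  rewrite !Rmult_1_l ![_ + c]Rplus_comm in H.
  eapply (@is_RInt_ext (real_restriction V)); [|exact (H (integral_correct f _ _ Hf))].
  intros s _. change (scal 1 (f (1 * s + c) : real_restriction V) = f (c + s)).
  rewrite Rmult_1_l Rplus_comm. exact (@scal_one R_Ring (real_restriction V) _).
Qed.

Lemma integral_reflect (f : R -> V) (t : R) :
  (forall s, continuous f s) ->
  integral (fun s => f (t - s)) 0 t = integral f 0 t.
Proof.
  intros Hf. apply integral_unique.
  pose proof (@is_RInt_comp_lin (real_restriction V) f (-1) t 0 t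
    (opp (integral f 0 t : real_restriction V))) as H.
  replace (-1 * 0 + t) with t in H by ring. replace (-1 * t + t) with 0 in H by ring.
  specialize (H (@is_RInt_swap (real_restriction V) f t 0 _ (integral_correct f 0 t Hf))).
  apply (@is_RInt_opp (real_restriction V)) in H. rewrite opp_opp in H.
  eapply (@is_RInt_ext (real_restriction V)); [|exact H].
  intros s _.
  change (opp (scal (opp (one : R_Ring)) (f (-1 * s + t) : real_restriction V))
    = f (t - s)).
  rewrite scal_opp_one opp_opp. f_equal. ring.
Qed.

End Integral.

Lemma integral_linear {V W : CompleteNormedModule C_AbsRing} (l : V -> W)
    (f : R -> V) (a b : R) :
  is_linear l -> (forall s, continuous f s) ->
  l (integral f a b) = integral (fun s => l (f s)) a b.
Proof.
  intros Hl Hf. symmetry. apply integral_unique.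
  apply (@is_RInt_linear (real_restriction V) (real_restriction W) l).
  - split.
    + exact (lin_plus l Hl).
    + intros k x. exact (lin_scal l Hl (RtoC k) x).
    + exact (lin_bound l Hl).
  - now apply integral_correct.
Qed.

(** * Convolution with a semigroup *)

(** The usual convolution, the integral of [T (t - s) (f s)], with the time variable
    reflected: then [t] enters the integrand only through [f], and continuity in [t]
    needs only the uniform continuity of [f].  Nothing is known about [T] at negative
    times, hence [Rmax 0 s]. *)
Definition duhamel {V : CompleteNormedModule C_AbsRing} (T : R -> V -> V)
    (f : R -> V) (t : R) : V :=
  integral (fun s => T (Rmax 0 s) (f (t - s))) 0 t.

Section Duhamel.

Context {V : CompleteNormedModule C_AbsRing} (T : R -> V -> V).
Hypothesis HT : c0_semigroup T.

Lemma duhamel_integrand_continuous (f : R -> V) (t : R) :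
  (forall s, continuous f s) ->
  forall s, continuous (fun s => T (Rmax 0 s) (f (t - s))) s.
Proof.
  intros Hf. apply (sg_continuous_along T HT (fun s => f (t - s))).
  now apply continuous_reflect.
Qed.

Lemma duhamel_ext (f g : R -> V) (t : R) :
  0 <= t -> (forall s, 0 <= s <= t -> f s = g s) -> duhamel T f t = duhamel T g t.
Proof.
  intros Ht Hfg. apply integral_ext; [exact Ht|]. intros s Hs. rewrite Hfg //. lra.
Qed.

Lemma duhamel_plus (f g : R -> V) (t : R) :
  (forall s, continuous f s) -> (forall s, continuous g s) -> 0 <= t ->
  duhamel T (fun s => plus (f s) (g s)) t = plus (duhamel T f t) (duhamel T g t).
Proof.
  intros Hf Hg Ht. unfold duhamel.
  rewrite -integral_plus; [|now apply duhamel_integrand_continuous..].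
  apply integral_ext; [exact Ht|]. intros s Hs. apply lin_plus, sg_linear; [exact HT|apply Rmax_l].
Qed.

Lemma duhamel_minus (f g : R -> V) (t : R) :
  (forall s, continuous f s) -> (forall s, continuous g s) -> 0 <= t ->
  duhamel T (fun s => minus (f s) (g s)) t = minus (duhamel T f t) (duhamel T g t).
Proof.
  intros Hf Hg Ht. unfold duhamel.
  rewrite -integral_minus; [|now apply duhamel_integrand_continuous..].
  apply integral_ext; [exact Ht|]. intros s Hs. apply lin_minus, sg_linear; [exact HT|apply Rmax_l].
Qed.

Lemma duhamel_restart (f : R -> V) (a b : R) :
  (forall s, continuous f s) -> 0 <= a -> 0 <= b ->
  duhamel T f (a + b) = plus (T b (duhamel T f a)) (duhamel T (fun s => f (a + s)) b).
Proof.
  intros Hf Ha Hb. unfold duhamel.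
  rewrite (integral_Chasles _ 0 b (a + b)); [|now apply duhamel_integrand_continuous].
  rewrite plus_comm. f_equal.
  - replace b with (b + 0) at 1 by ring. rewrite (Rplus_comm a b).
    rewrite integral_shift; [|now apply duhamel_integrand_continuous].
    rewrite (integral_linear (T b)); [|now apply sg_linear|now apply duhamel_integrand_continuous].
    apply integral_ext; [exact Ha|]. intros s Hs.
    rewrite !Rmax_right; [|lra|lra]. rewrite (sg_add T HT); [|lra|lra].
    f_equal. f_equal. f_equal. ring.
  - apply integral_ext; [exact Hb|]. intros s Hs. f_equal. f_equal. ring.
Qed.

(** In the norm weighted by [exp (mu * t)] convolution with [T] has norm at most
    [M / mu], so it is a contraction for large [mu], on intervals of any length. *)
Lemma duhamel_exp_bound (f : R -> V) (a M C mu t : R) :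
  (forall s x, 0 <= s <= a -> norm (T s x) <= M * norm x) ->
  (forall s, continuous f s) -> 0 <= M -> 0 < mu -> 0 <= t <= a -> 0 <= C ->
  (forall s, 0 <= s <= t -> norm (f s) <= C * exp (mu * s)) ->
  norm (duhamel T f t) <= M * C / mu * exp (mu * t).
Proof.
  intros HM Hf HM0 Hmu Ht HC Hfb.
  eapply Rle_trans.
  - apply (integral_norm_le _ (fun s => M * (C * exp (mu * (t - s))))
      0 t (M * C / mu * exp (mu * t) - M * C / mu)).
    + lra.
    + now apply duhamel_integrand_continuous.
    + intros s Hs. rewrite Rmax_right; [|lra].
      eapply Rle_trans; [apply HM; lra|]. apply Rmult_le_compat_l; [exact HM0|].
      apply Hfb. lra.
    + replace (M * C / mu * exp (mu * t) - M * C / mu) with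
        (minus (- (M * C / mu) * exp (mu * (t - t))) (- (M * C / mu) * exp (mu * (t - 0)))).
      * apply (is_RInt_derive (fun s => - (M * C / mu) * exp (mu * (t - s)))).
        -- intros s _. auto_derive; [trivial|]. unfold Rminus. field. lra.
        -- intros s _. apply (ex_derive_continuous (V := R_NormedModule)). auto_derive. trivial.
      * unfold minus, plus, opp; simpl. rewrite Rminus_diag Rmult_0_r exp_0 Rminus_0_r. ring.
  - assert (0 <= M * C / mu); [|lra].
    apply Rmult_le_pos; [now apply Rmult_le_pos|]. now apply Rlt_le, Rinv_0_lt_compat.
Qed.

Lemma duhamel_continuous (f : R -> V) :
  (forall s, continuous f s) -> forall t, continuous (fun s => duhamel T f (Rmax 0 s)) t.
Proof.
  intros Hf. apply continuous_of_uniform. intros a eps He.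
  destruct (sg_bounded T HT a) as (M & HM1 & HM).
  destruct (continuous_bounded f a Hf) as (C & HC0 & HC).
  assert (He' : 0 < eps / (2 * M * (Rabs a + 1))).
  { apply Rdiv_lt_0_compat; [lra|]. pose proof (Rabs_pos a). nra. }
  destruct (unifcont_normed_1d f 0 a (fun s _ => Hf s) (mkposreal _ He')) as [d Hd].
  assert (HMC : 0 < 2 * M * (C + 1)) by nra.
  exists (Rmin d (eps / (2 * M * (C + 1)))).
  split; [apply Rmin_pos; [apply cond_pos|now apply Rdiv_lt_0_compat]|].
  intros s t Hs Ht Hst.
  assert (Hst1 : t - s < d) by (eapply Rlt_le_trans; [exact Hst|apply Rmin_l]).
  assert (Hst2 : t - s < eps / (2 * M * (C + 1)))
    by (eapply Rlt_le_trans; [exact Hst|apply Rmin_r]).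
  unfold duhamel.
  rewrite (integral_Chasles _ 0 s t); [|now apply duhamel_integrand_continuous].
  set (I1 := integral _ 0 s). set (I2 := integral _ s t). set (I3 := integral _ 0 s).
  assert (H1 : norm (minus I1 I3) <= s * (eps / (2 * (Rabs a + 1)))).
  { unfold I1, I3.
    rewrite -integral_minus; [|now apply duhamel_integrand_continuous..].
    replace (s * _) with ((s - 0) * (eps / (2 * (Rabs a + 1)))) by ring.
    apply integral_norm_le_const; [lra| |].
    - intros r. apply (continuous_minus (K := C_AbsRing) (V := V));
        now apply duhamel_integrand_continuous.
    - intros r Hr. rewrite Rmax_right; [|lra].
      rewrite -(lin_minus (T r)); [|apply sg_linear; [exact HT|lra]].
      eapply Rle_trans; [apply HM; lra|].
      apply Rle_trans with (M * (eps / (2 * M * (Rabs a + 1)))).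
      + apply Rmult_le_compat_l; [lra|]. apply Rlt_le. rewrite norm_minus_sym.
        apply (Hd (t - r) (s - r)); [lra|lra|].
        change (Rabs (s - r - (t - r)) < d). rewrite Rabs_left1; lra.
      + apply Req_le. field. pose proof (Rabs_pos a). lra. }
  assert (H2 : norm I2 <= (t - s) * (M * C)).
  { apply integral_norm_le_const; [lra|now apply duhamel_integrand_continuous|].
    intros r Hr. rewrite Rmax_right; [|lra].
    eapply Rle_trans; [apply HM; lra|]. apply Rmult_le_compat_l; [lra|]. apply HC. lra. }
  assert (H3 : minus (plus I1 I2) I3 = plus (minus I1 I3) I2).
  { rewrite -{1}(plus_zero_r I3) minus_plus_plus. f_equal.
    rewrite -{2}(minus_plus_cancel zero I2). now rewrite plus_zero_l. }
  rewrite H3.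
  pose proof (norm_triangle (minus I1 I3) I2) as H4.
  assert (H5 : s * (eps / (2 * (Rabs a + 1))) < eps / 2).
  { pose proof (Rle_abs a). pose proof (Rabs_pos a).
    apply Rlt_le_trans with ((Rabs a + 1) * (eps / (2 * (Rabs a + 1)))).
    - apply Rmult_lt_compat_r; [apply Rdiv_lt_0_compat; lra|lra].
    - apply Req_le. field. lra. }
  assert (H6 : (t - s) * (M * C) <= eps / 2).
  { apply Rle_trans with (eps / (2 * M * (C + 1)) * (M * (C + 1))).
    - apply Rmult_le_compat; [lra|nra|lra|nra].
    - apply Req_le. field. lra. }
  eapply Rle_lt_trans; [exact H4|]. lra.
Qed.

End Duhamel.

Lemma duhamel_intertwine {V W : CompleteNormedModule C_AbsRing} (T : R -> V -> V)
    (T1 : R -> W -> W) (l : V -> W) (f : R -> V) (t : R) :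
  c0_semigroup T -> is_linear l ->
  (forall s x, 0 <= s -> T1 s (l x) = l (T s x)) ->
  (forall s, continuous f s) -> 0 <= t ->
  l (duhamel T f t) = duhamel T1 (fun s => l (f s)) t.
Proof.
  intros HT Hl HTl Hf Ht. unfold duhamel.
  rewrite integral_linear //; [|now apply duhamel_integrand_continuous].
  apply integral_ext; [exact Ht|]. intros s _. now rewrite HTl; [|apply Rmax_l].
Qed.

(** * Lipschitz Volterra equations *)

Lemma lipschitz_continuous {V : CompleteNormedModule C_AbsRing} (phi : V -> V) (L : R)
    (z : R -> V) :
  (forall x y, norm (minus (phi x) (phi y)) <= L * norm (minus x y)) ->
  (forall s, continuous z s) -> forall s, continuous (fun s => phi (z s)) s.
Proof.
  intros HL Hz s. apply continuous_norm_iff. intros eps He.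
  assert (HL1 : 0 < Rabs L + 1) by (pose proof (Rabs_pos L); lra).
  destruct (proj1 (continuous_norm_iff z s) (Hz s) (eps / (Rabs L + 1))) as (d & Hd & H).
  { now apply Rdiv_lt_0_compat. }
  exists d. split; [exact Hd|]. intros r Hr. specialize (H r Hr).
  eapply Rle_lt_trans; [apply HL|].
  apply Rle_lt_trans with ((Rabs L + 1) * norm (minus (z r) (z s))).
  - apply Rmult_le_compat_r; [apply norm_ge_0|]. pose proof (Rle_abs L). lra.
  - apply Rmult_lt_compat_l with (r := Rabs L + 1) in H; [|exact HL1].
    replace ((Rabs L + 1) * (eps / (Rabs L + 1))) with eps in H by (field; lra). exact H.
Qed.

Section Volterra.

Context {V : CompleteNormedModule C_AbsRing} (T : R -> V -> V).
Hypothesis HT : c0_semigroup T.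

(** Gronwall's inequality: at the maximum [K] of [exp (- mu * s) * norm (z s)] the
    convolution contributes at most [K / 2], so [K <= C + K / 2]. *)
Lemma volterra_bound (z f : R -> V) (a M L mu C : R) :
  (forall s x, 0 <= s <= a -> norm (T s x) <= M * norm x) -> 0 <= M -> 0 <= L -> 0 <= C ->
  2 * (M * L) <= mu -> 0 < mu ->
  (forall s, continuous z s) -> (forall s, continuous f s) ->
  (forall s, 0 <= s <= a -> norm (f s) <= L * norm (z s)) ->
  (forall t, 0 <= t <= a -> norm (z t) <= C + norm (duhamel T f t)) ->
  forall t, 0 <= t <= a -> norm (z t) <= 2 * C * exp (mu * t).
Proof.
  intros HM HM0 HL0 HC0 Hmu Hmu0 Hz Hf Hfz Heq t Ht.
  assert (Hexp : forall s, exp (- mu * s) * exp (mu * s) = 1).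
  { intros s. rewrite -exp_plus. replace (- mu * s + mu * s) with 0 by ring. apply exp_0. }
  destruct (continuity_ab_maj (fun s => exp (- mu * s) * norm (z s)) 0 a) as (m & Hmax & Hm).
  { lra. }
  { intros c _. apply continuity_pt_filterlim.
    apply (continuous_mult (K := R_AbsRing) (fun s => exp (- mu * s)) (fun s => norm (z s))).
    - apply (ex_derive_continuous (V := R_NormedModule)). auto_derive. trivial.
    - apply (filterlim_comp _ _ _ z norm _ (locally (z c))); [apply Hz|].
      exact (filterlim_norm (z c)). }
  set (K := exp (- mu * m) * norm (z m)) in *.
  assert (HK0 : 0 <= K) by (apply Rmult_le_pos; [apply Rlt_le, exp_pos|apply norm_ge_0]).
  assert (HK : forall s, 0 <= s <= a -> norm (z s) <= K * exp (mu * s)).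
  { intros s Hs. specialize (Hmax s Hs).
    apply Rmult_le_compat_r with (r := exp (mu * s)) in Hmax; [|apply Rlt_le, exp_pos].
    replace (norm (z s)) with (exp (- mu * s) * norm (z s) * exp (mu * s)); [exact Hmax|].
    transitivity (norm (z s) * (exp (- mu * s) * exp (mu * s))); [ring|].
    rewrite Hexp. ring. }
  assert (HKC : K <= 2 * C).
  { assert (Hd : norm (duhamel T f m) <= M * (L * K) / mu * exp (mu * m)).
    { apply (duhamel_exp_bound T HT f a); try assumption.
      - now apply Rmult_le_pos.
      - intros s Hs. eapply Rle_trans; [apply Hfz; lra|]. rewrite Rmult_assoc.
        apply Rmult_le_compat_l; [exact HL0|]. apply HK. lra. }
    assert (Hhalf : M * (L * K) / mu <= K / 2).
    { apply (Rmult_le_reg_r mu); [exact Hmu0|].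
      replace (M * (L * K) / mu * mu) with (M * L * K) by (field; lra). nra. }
    specialize (Heq m Hm).
    assert (H1 : norm (z m) <= C + K / 2 * exp (mu * m)).
    { pose proof (exp_pos (mu * m)). nra. }
    assert (H2 : exp (- mu * m) <= 1).
    { rewrite -exp_0. apply exp_monotone. nra. }
    pose proof (exp_pos (- mu * m)).
    apply Rmult_le_compat_l with (r := exp (- mu * m)) in H1; [|lra].
    fold K in H1.
    replace (exp (- mu * m) * (C + K / 2 * exp (mu * m))) with
      (exp (- mu * m) * C + K / 2 * (exp (- mu * m) * exp (mu * m))) in H1 by ring.
    rewrite Hexp in H1. nra. }
  eapply Rle_trans; [now apply HK|].
  apply Rmult_le_compat_r; [apply Rlt_le, exp_pos|exact HKC].
Qed.

Context (phi : V -> V) (L : R).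
Hypothesis HL0 : 0 <= L.
Hypothesis HL : forall x y, norm (minus (phi x) (phi y)) <= L * norm (minus x y).

Lemma volterra_unique (g z1 z2 : R -> V) (a : R) :
  (forall s, continuous z1 s) -> (forall s, continuous z2 s) ->
  (forall t, 0 <= t <= a -> z1 t = plus (g t) (duhamel T (fun s => phi (z1 s)) t)) ->
  (forall t, 0 <= t <= a -> z2 t = plus (g t) (duhamel T (fun s => phi (z2 s)) t)) ->
  forall t, 0 <= t <= a -> z1 t = z2 t.
Proof.
  intros Hz1 Hz2 H1 H2 t Ht. destruct (sg_bounded T HT a) as (M & HM1 & HM).
  assert (Hp1 := lipschitz_continuous phi L z1 HL Hz1).
  assert (Hp2 := lipschitz_continuous phi L z2 HL Hz2).
  apply norm_minus_zero_eq.
  replace 0 with (2 * 0 * exp ((2 * (M * L) + 1) * t)) by ring.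
  apply (volterra_bound (fun s => minus (z1 s) (z2 s))
    (fun s => minus (phi (z1 s)) (phi (z2 s))) a M L); try nra; try assumption.
  - intros s. apply (continuous_minus (K := C_AbsRing) (V := V)); [apply Hz1|apply Hz2].
  - intros s. apply (continuous_minus (K := C_AbsRing) (V := V)); [apply Hp1|apply Hp2].
  - intros s _. apply HL.
  - intros s Hs. rewrite (duhamel_minus T HT); [|exact Hp1|exact Hp2|lra].
    rewrite (H1 s Hs) (H2 s Hs) minus_plus_l. lra.
Qed.

Fixpoint picard (g : R -> V) (n : nat) (t : R) : V :=
  match n with
  | O => g (Rmax 0 t)
  | S n => plus (g (Rmax 0 t)) (duhamel T (fun s => phi (picard g n s)) (Rmax 0 t))
  end.

Lemma picard_continuous (g : R -> V) (n : nat) :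
  (forall s, continuous (fun s => g (Rmax 0 s)) s) -> forall s, continuous (picard g n) s.
Proof.
  intros Hg. induction n as [|n IH]; [exact Hg|].
  intros s. simpl. apply (continuous_plus (K := C_AbsRing) (V := V)); [apply Hg|].
  apply (duhamel_continuous T HT), (lipschitz_continuous phi L); assumption.
Qed.

(** The increments halve in the norm weighted by [exp (mu * t)]; since the time
    interval is bounded above, the weight is absorbed in the constant. *)
Lemma picard_contracts (g : R -> V) (a : R) :
  (forall s, continuous (fun s => g (Rmax 0 s)) s) ->
  exists C, 0 <= C /\ forall n t, t <= a ->
    norm (minus (picard g (S n) t) (picard g n t)) <= C / 2 ^ n.
Proof.
  intros Hg. set (b := Rmax 0 a).
  destruct (sg_bounded T HT b) as (M & HM1 & HM).
  assert (Hpc := fun n => picard_continuous g n Hg).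
  assert (Hfc := fun n => lipschitz_continuous phi L _ HL (Hpc n)).
  destruct (continuous_bounded
    (fun s => duhamel T (fun s => phi (picard g 0 s)) (Rmax 0 s)) b) as (C & HC0 & HC).
  { now apply duhamel_continuous. }
  set (mu := 2 * (M * L) + 1). assert (Hmu : 0 < mu) by (unfold mu; nra).
  assert (Hn : forall n t, 0 <= t <= b ->
    norm (minus (picard g (S n) t) (picard g n t)) <= C / 2 ^ n * exp (mu * t)).
  { induction n as [|n IH]; intros t Ht.
    - change (picard g 1 t) with
        (plus (picard g 0 t) (duhamel T (fun s => phi (picard g 0 s)) (Rmax 0 t))).
      rewrite minus_plus_cancel. eapply Rle_trans; [now apply HC|].
      simpl. unfold Rdiv. rewrite Rinv_1 Rmult_1_r.
      rewrite -{1}(Rmult_1_r C). apply Rmult_le_compat_l; [exact HC0|].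
      rewrite -exp_0. apply exp_monotone. nra.
    - change (picard g (S (S n)) t) with
        (plus (g (Rmax 0 t)) (duhamel T (fun s => phi (picard g (S n) s)) (Rmax 0 t))).
      change (picard g (S n) t) with
        (plus (g (Rmax 0 t)) (duhamel T (fun s => phi (picard g n s)) (Rmax 0 t))).
      rewrite minus_plus_l Rmax_right; [|lra].
      assert (H2 : 0 < 2 ^ n) by (apply pow_lt; lra).
      assert (HC2 : 0 <= C / 2 ^ n)
        by (apply Rmult_le_pos; [lra|now apply Rlt_le, Rinv_0_lt_compat]).
      rewrite -(duhamel_minus T HT); [|exact (Hfc (S n))|exact (Hfc n)|lra].
      eapply Rle_trans.
      + apply (duhamel_exp_bound T HT _ b M (L * (C / 2 ^ n)) mu); try assumption; try lra.
        * intros s. apply (continuous_minus (K := C_AbsRing) (V := V));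
            [exact (Hfc (S n) s)|exact (Hfc n s)].
        * now apply Rmult_le_pos.
        * intros s Hs. eapply Rle_trans; [apply HL|]. rewrite Rmult_assoc.
          apply Rmult_le_compat_l; [exact HL0|]. apply IH. lra.
      + apply Rmult_le_compat_r; [apply Rlt_le, exp_pos|].
        replace (C / 2 ^ S n) with (C / 2 ^ n / 2) by (simpl; field; lra).
        apply (Rmult_le_reg_r mu); [exact Hmu|].
        replace (M * (L * (C / 2 ^ n)) / mu * mu) with (M * L * (C / 2 ^ n))
          by (field; lra).
        unfold mu. nra. }
  exists (C * exp (mu * b)). split.
  { apply Rmult_le_pos; [exact HC0|apply Rlt_le, exp_pos]. }
  intros n t Ht.
  assert (Hclamp : forall k, picard g k t = picard g k (Rmax 0 t)).
  { intros k. destruct k; simpl; now rewrite (Rmax_right 0 (Rmax 0 t) (Rmax_l _ _)). }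
  rewrite (Hclamp n) (Hclamp (S n)).
  assert (Ht' : 0 <= Rmax 0 t <= b).
  { split; [apply Rmax_l|]. unfold b. now apply Rle_max_compat_l. }
  eapply Rle_trans; [now apply Hn|].
  assert (H2 : 0 < / 2 ^ n) by (apply Rinv_0_lt_compat, pow_lt; lra).
  unfold Rdiv. rewrite !Rmult_assoc. apply Rmult_le_compat_l; [exact HC0|].
  rewrite Rmult_comm. apply Rmult_le_compat_r; [lra|]. apply exp_monotone. nra.
Qed.

Lemma volterra_exists (g : R -> V) :
  (forall s, continuous (fun s => g (Rmax 0 s)) s) ->
  exists z, (forall s, continuous z s) /\
    forall t, 0 <= t -> z t = plus (g t) (duhamel T (fun s => phi (z s)) t).
Proof.
  intros Hg.
  assert (Hlim : forall a t, t <= a -> exists C, 0 <= C /\ exists l,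
    forall n, norm (minus l (picard g n t)) <= C / 2 ^ n).
  { intros a t Ht. destruct (picard_contracts g a Hg) as (C & HC0 & HC).
    exists (2 * C). split; [lra|]. apply geometric_limit; [exact HC0|].
    intros n. now apply HC. }
  assert (Hz : exists z : R -> V, forall t, exists C, 0 <= C /\
    forall n, norm (minus (z t) (picard g n t)) <= C / 2 ^ n).
  { apply (functional_choice (fun t l => exists C, 0 <= C /\
      forall n, norm (minus l (picard g n t)) <= C / 2 ^ n)).
    intros t. destruct (Hlim t t (Rle_refl t)) as (C & HC & l & Hl). now exists l, C. }
  destruct Hz as [z Hz].
  (* The bound of each [z t] depends on [t]; uniqueness of limits makes it uniform
     on half-lines bounded above. *)
  assert (Hu : forall a, exists C, 0 <= C /\ forall n t, t <= a ->
    norm (minus (z t) (picard g n t)) <= C / 2 ^ n).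
  { intros a. destruct (picard_contracts g a Hg) as (C & HC0 & HC).
    exists (2 * C). split; [lra|]. intros n t Ht.
    destruct (geometric_limit (fun n => picard g n t) C HC0 (fun n => HC n t Ht)) as [l Hl].
    destruct (Hz t) as (C' & HC'0 & HC').
    replace (z t) with l; [apply Hl|].
    apply norm_minus_zero_eq, (le_div_pow2_zero _ (2 * C + C')); [lra|]. intros k.
    pose proof (norm_minus_triangle (picard g k t) l (z t)) as H.
    rewrite (norm_minus_sym (picard g k t)) in H.
    specialize (Hl k). specialize (HC' k). simpl in Hl. unfold Rdiv in *. lra. }
  assert (Hzc : forall s, continuous z s).
  { intros s. apply continuous_norm_iff. intros eps He.
    destruct (Hu (s + 1)) as (C & HC0 & HC).
    destruct (div_pow2_small C (eps / 3) HC0) as [n Hn]; [lra|].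
    destruct (proj1 (continuous_norm_iff _ _) (picard_continuous g n Hg s) (eps / 3))
      as (d & Hd & Hpd); [lra|].
    exists (Rmin d 1). split; [apply Rmin_pos; lra|]. intros r Hr.
    assert (Hr1 : Rabs (r - s) < d) by (eapply Rlt_le_trans; [exact Hr|apply Rmin_l]).
    assert (Hr2 : Rabs (r - s) < 1) by (eapply Rlt_le_trans; [exact Hr|apply Rmin_r]).
    apply Rabs_def2 in Hr2. specialize (Hpd r Hr1).
    pose proof (HC n r ltac:(lra)). pose proof (HC n s ltac:(lra)) as Hs.
    rewrite norm_minus_sym in Hs.
    pose proof (norm_minus_triangle (picard g n r) (z r) (z s)).
    pose proof (norm_minus_triangle (picard g n s) (picard g n r) (z s)). lra. }
  exists z. split; [exact Hzc|]. intros t Ht.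
  destruct (Hu t) as (C & HC0 & HC). destruct (sg_bounded T HT t) as (M & HM1 & HM).
  assert (HfM : 0 <= M * (L * C) / 1 * exp (1 * t)).
  { apply Rmult_le_pos; [|apply Rlt_le, exp_pos]. unfold Rdiv. rewrite Rinv_1 Rmult_1_r.
    repeat apply Rmult_le_pos; lra. }
  apply norm_minus_zero_eq, (le_div_pow2_zero _ (C + M * (L * C) / 1 * exp (1 * t))); [lra|].
  intros n.
  pose proof (norm_minus_triangle (picard g (S n) t) (z t)
    (plus (g t) (duhamel T (fun s => phi (z s)) t))) as H.
  pose proof (HC (S n) t (Rle_refl t)) as H1.
  change (picard g (S n) t) with
    (plus (g (Rmax 0 t)) (duhamel T (fun s => phi (picard g n s)) (Rmax 0 t))) in H at 2.
  assert (Hfc := lipschitz_continuous phi L _ HL (picard_continuous g n Hg)).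
  assert (Hfz := lipschitz_continuous phi L z HL Hzc).
  rewrite (Rmax_right 0 t Ht) minus_plus_l -(duhamel_minus T HT) // in H.
  assert (H2 : 0 < / 2 ^ n) by (apply Rinv_0_lt_compat, pow_lt; lra).
  assert (H3 : norm (duhamel T (fun s => minus (phi (picard g n s)) (phi (z s))) t)
    <= M * (L * (C / 2 ^ n)) / 1 * exp (1 * t)).
  { apply (duhamel_exp_bound T HT _ t); try assumption; try lra.
    - intros s. apply (continuous_minus (K := C_AbsRing) (V := V)); [apply Hfc|apply Hfz].
    - repeat apply Rmult_le_pos; lra.
    - intros s Hs. eapply Rle_trans; [apply HL|]. rewrite norm_minus_sym Rmult_assoc.
      apply Rmult_le_compat_l; [exact HL0|].
      eapply Rle_trans; [apply HC; lra|]. rewrite -{1}(Rmult_1_r (C / 2 ^ n)).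
      apply Rmult_le_compat_l; [apply Rmult_le_pos; lra|].
      apply Rle_trans with (exp 0); [rewrite exp_0; lra|apply exp_monotone; lra]. }
  assert (H4 : C / 2 ^ S n <= C / 2 ^ n).
  { simpl. unfold Rdiv. rewrite Rinv_mult. nra. }
  replace (M * (L * (C / 2 ^ n)) / 1 * exp (1 * t)) with
    (M * (L * C) / 1 * exp (1 * t) / 2 ^ n) in H3 by (unfold Rdiv; ring).
  unfold Rdiv in *. lra.
Qed.

End Volterra.

(** * The response to a held input *)

Lemma duhamel_at_zero {V : CompleteNormedModule C_AbsRing} (T : R -> V -> V) (f : R -> V) :
  duhamel T f 0 = zero.
Proof. exact (@RInt_point (real_restriction V) 0 _). Qed.

Lemma duhamel_zero {V : CompleteNormedModule C_AbsRing} (T : R -> V -> V) (t : R) :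
  c0_semigroup T -> 0 <= t -> duhamel T (fun _ => zero) t = zero.
Proof.
  intros HT Ht.
  pose proof (duhamel_minus T HT (fun _ => zero) (fun _ => zero) t) as H.
  rewrite !minus_eq_zero in H. apply H; [intros; apply continuous_const..|exact Ht].
Qed.

(** [norm (j x) = norm (Rl x)] and the resolvent is injective. *)
Lemma extrapolation_injective {X Xm1 : CompleteNormedModule C_AbsRing}
    (A : X -> X -> Prop) (T : R -> X -> X) (lambda : C) (Rl : X -> X) (j : X -> Xm1) :
  generates A T -> is_resolvent A lambda Rl -> is_extrapolation_space Rl j ->
  forall x y, j x = j y -> x = y.
Proof.
  intros [HT HA] (HRl & Hsurj & _) (Hj & Hnorm & _) x y Hxy.
  set (d := minus x y).
  assert (Hd : Rl d = zero).
  { apply: norm_eq_zero. rewrite -Hnorm. unfold d.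
    now rewrite (lin_minus j Hj) Hxy minus_eq_zero norm_zero. }
  destruct (Hsurj d) as (w & Hw & Hwd). rewrite Hd in Hw, Hwd.
  assert (Hw0 : w = zero).
  { apply HA in Hw. apply: (filterlim_locally_unique (K := C_AbsRing) (V := X)
      (F := at_right 0)); [exact Hw|].
    apply (filterlim_within_ext (fun t => 0 < t) (fun _ => (zero : X))); [|apply filterlim_const].
    intros t Ht. rewrite (lin_zero (T t)); [|apply sg_linear; [exact HT|lra]].
    rewrite minus_eq_zero. symmetry. exact (scal_zero_r (RtoC (/ t))). }
  apply minus_zero_eq. fold d. rewrite -Hwd Hw0.
  assert (H0 : scal lambda (zero : X) = zero) by exact (scal_zero_r lambda).
  rewrite H0. exact (minus_eq_zero (zero : X)).
Qed.

Section HeldInput.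

Context {X U Xm1 : CompleteNormedModule C_AbsRing}.
Context (j : X -> Xm1) (T : R -> X -> X) (Tm1 : R -> Xm1 -> Xm1).
Context (B : U -> Xm1) (F : X -> U).
Hypothesis HT : c0_semigroup T.
Hypothesis HTm1 : c0_semigroup Tm1.
Hypothesis Hext : forall t x, 0 <= t -> Tm1 t (j x) = j (T t x).
Hypothesis Hj : is_linear j.
Hypothesis Hinj : forall x y, j x = j y -> x = y.
Hypothesis HB : is_linear B.
Hypothesis HF : is_linear F.

(** The integral splits into the contribution of the held input, which a priori lies in
    [Xm1] only, and the image under [j] of a convolution in [X]. *)
Lemma hold_equation_duhamel (phi : X -> X) (xi : X) (z zc : R -> X) (tau : R) :
  0 <= tau -> (forall s, continuous (fun s => phi (zc s)) s) ->
  (forall s, 0 <= s <= tau -> z s = zc s) ->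
  hold_equation j T Tm1 B F phi xi z tau <->
  j (z tau) = plus (j (T tau xi))
    (plus (duhamel Tm1 (fun _ => B (F xi)) tau)
          (j (duhamel T (fun s => phi (zc s)) tau))).
Proof.
  intros Htau Hzc Hz.
  set (c := fun s => plus (B (F xi)) (j (phi (zc s)))).
  assert (Hjc : forall s, continuous (fun s => j (phi (zc s))) s).
  { intros s. apply (continuous_comp (fun s => phi (zc s)) j); [apply Hzc|].
    exact (linear_cont j _ Hj). }
  assert (Hc : forall s, continuous c s).
  { intros s. apply (continuous_plus (K := C_AbsRing) (V := Xm1));
      [apply continuous_const|apply Hjc]. }
  assert (HI : @is_RInt (real_restriction Xm1)
      (fun s => Tm1 (tau - s) (plus (B (F xi)) (j (phi (z s))))) 0 tau
      (duhamel Tm1 c tau)).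
  { pose proof (duhamel_integrand_continuous Tm1 HTm1 c tau Hc) as Hcc.
    unfold duhamel. rewrite -integral_reflect //.
    eapply (@is_RInt_ext (real_restriction Xm1));
      [|exact (integral_correct _ 0 tau (continuous_reflect _ tau Hcc))].
    intros s Hs. rewrite Rmin_left // Rmax_right // in Hs.
    unfold c. rewrite Rmax_right; [|lra]. replace (tau - (tau - s)) with s by ring.
    rewrite Hz //. lra. }
  rewrite (duhamel_intertwine T Tm1 j) //.
  rewrite -(duhamel_plus Tm1 HTm1) //; [|intros; apply continuous_const].
  split.
  - intros (I & HI' & ->). f_equal.
    pose proof (@is_RInt_unique (real_restriction Xm1) _ _ _ _ HI) as E.
    rewrite -(@is_RInt_unique (real_restriction Xm1) _ _ _ _ HI'). exact E.
  - intros E. exists (duhamel Tm1 c tau). now split.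
Qed.

Context (h : R).
Hypothesis Hh : 0 < h.
Hypothesis Hper : exp_stable_system (periodic_solution j T Tm1 B F h).

(** On the first sampling interval the periodic solution is the semigroup orbit plus the
    response to the held input, so the latter belongs to [X]. *)
Lemma periodic_first_step : exists Gamma, 1 <= Gamma /\ forall xi, exists x : R -> X,
  (forall s, continuous (fun s => x (Rmax 0 s)) s) /\ x 0 = xi /\
  (forall t, 0 <= t <= h -> norm (x t) <= Gamma * norm xi /\
     j (minus (x t) (T t xi)) = duhamel Tm1 (fun _ => B (F xi)) t).
Proof.
  destruct Hper as (Gamma & gamma & HG & Hg & Hsol). exists Gamma. split; [exact HG|].
  intros xi. destruct (Hsol xi) as (x & (Hc & H0 & Heq) & _ & Hdecay). exists x.
  split; [now apply continuous_on_nonneg|]. split; [exact H0|]. intros t Ht. split.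
  - eapply Rle_trans; [apply Hdecay; lra|].
    apply Rmult_le_compat_r; [apply norm_ge_0|]. rewrite -{2}(Rmult_1_r Gamma).
    apply Rmult_le_compat_l; [lra|].
    apply Rle_trans with (exp 0); [apply exp_monotone; nra|rewrite exp_0; lra].
  - rewrite (lin_minus j Hj). destruct (proj1 Ht) as [Htpos|<-].
    + specialize (Heq 0%nat t). simpl INR in Heq. rewrite Rmult_0_l Rmult_1_l H0 in Heq.
      specialize (Heq ltac:(lra)).
      apply (hold_equation_duhamel _ _ _ (fun s => x (0 + Rmax 0 s))) in Heq.
      * rewrite Rplus_0_l in Heq. rewrite Heq (duhamel_zero T t HT (proj1 Ht)) (lin_zero j Hj) plus_zero_r.
        apply: minus_plus_cancel.
      * lra.
      * intros s. apply continuous_const.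
      * intros s Hs. rewrite Rmax_right //. lra.
    + rewrite duhamel_at_zero sg_zero // H0. apply: minus_eq_zero.
Qed.

(** The first sampling interval gives the response up to time [h], with the bound and
    the limit at [0]; longer times are reached in steps of [h] by the restart identity
    of the convolution. *)
Lemma hold_response_exists : exists (G : X -> R -> X) (K : R), 0 <= K /\
  (forall xi t, 0 <= t -> j (G xi t) = duhamel Tm1 (fun _ => B (F xi)) t) /\
  (forall xi t, 0 <= t <= h -> norm (G xi t) <= K * norm xi) /\
  (forall xi eps, 0 < eps ->
     exists d, 0 < d /\ forall t, 0 <= t < d -> norm (G xi t) < eps).
Proof.
  destruct periodic_first_step as (Gamma & HG & Hx).
  assert (Hn : forall n xi t, 0 <= t <= INR n * h ->
    exists g, j g = duhamel Tm1 (fun _ => B (F xi)) t).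
  { induction n as [|n IH]; intros xi t Ht.
    - simpl in Ht. exists zero. replace t with 0 by lra.
      now rewrite duhamel_at_zero (lin_zero j Hj).
    - rewrite S_INR in Ht. destruct (Hx xi) as (x & _ & _ & Hxt).
      destruct (Rle_dec t h) as [Hth|Hth].
      + eexists. apply Hxt. lra.
      + destruct (IH xi (t - h)) as [g Hg]; [lra|].
        exists (plus (T (t - h) (minus (x h) (T h xi))) g).
        replace t with (h + (t - h)) at 2 by ring.
        rewrite (duhamel_restart Tm1 HTm1); [|intros; apply continuous_const|lra|lra].
        rewrite (lin_plus j Hj) Hg -Hext; [|lra].
        destruct (Hxt h) as [_ ->]; [lra|reflexivity]. }
  assert (HGex : exists G : X * R -> X, forall p, 0 <= snd p ->
    j (G p) = duhamel Tm1 (fun _ => B (F (fst p))) (snd p)).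
  { apply (functional_choice (fun (p : X * R) g => 0 <= snd p ->
      j g = duhamel Tm1 (fun _ => B (F (fst p))) (snd p))).
    intros [xi t]. simpl. destruct (Rle_dec 0 t) as [Ht|Ht].
    - destruct (nfloor_ex (t / h)) as [n [_ Hnt]].
      { apply Rmult_le_pos; [exact Ht|now apply Rlt_le, Rinv_0_lt_compat]. }
      destruct (Hn (S n) xi t) as [g Hg]; [|now exists g].
      split; [exact Ht|]. rewrite S_INR.
      apply Rmult_lt_compat_r with (r := h) in Hnt; [|exact Hh].
      replace (t / h * h) with t in Hnt by (field; lra). lra.
    - exists zero. intros; lra. }
  destruct HGex as [G HGp]. destruct (sg_bounded T HT h) as (M & HM1 & HM).
  exists (fun xi t => G (xi, t)), (Gamma + M).
  assert (HGj : forall xi t, 0 <= t -> j (G (xi, t)) = duhamel Tm1 (fun _ => B (F xi)) t)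
    by (intros xi t; exact (HGp (xi, t))).
  assert (HGx : forall xi, exists x : R -> X,
    (forall s, continuous (fun s => x (Rmax 0 s)) s) /\ x 0 = xi /\
    forall t, 0 <= t <= h -> norm (x t) <= Gamma * norm xi /\
      G (xi, t) = minus (x t) (T t xi)).
  { intros xi. destruct (Hx xi) as (x & Hc & H0 & Hxt). exists x.
    split; [exact Hc|split; [exact H0|]]. intros t Ht.
    destruct (Hxt t Ht) as [H1 H2]. split; [exact H1|]. apply Hinj.
    rewrite HGj; [now rewrite H2|lra]. }
  split; [lra|]. split; [exact HGj|]. split.
  - intros xi t Ht. destruct (HGx xi) as (x & _ & _ & Hxt).
    destruct (Hxt t Ht) as [H1 ->].
    eapply Rle_trans; [apply norm_minus_le|].
    specialize (HM t xi Ht). lra.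
  - intros xi eps He. destruct (HGx xi) as (x & Hc & H0 & Hxt).
    destruct (sg_near_zero T HT xi (eps / 2)) as (d1 & Hd1 & H1); [lra|].
    destruct (proj1 (continuous_norm_iff _ _) (Hc 0) (eps / 2)) as (d2 & Hd2 & H2); [lra|].
    exists (Rmin h (Rmin d1 d2)). split; [repeat apply Rmin_pos; lra|]. intros t [Ht0 Ht].
    assert (Hth : t < h) by (eapply Rlt_le_trans; [exact Ht|apply Rmin_l]).
    assert (Ht2 : t < Rmin d1 d2) by (eapply Rlt_le_trans; [exact Ht|apply Rmin_r]).
    destruct (Hxt t) as [_ ->]; [lra|].
    specialize (H1 t (conj Ht0 (Rlt_le_trans _ _ _ Ht2 (Rmin_l _ _)))).
    specialize (H2 t). simpl in H2. rewrite !Rmax_right ?H0 in H2; [|lra|lra].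
    specialize (H2 ltac:(rewrite Rminus_0_r Rabs_pos_eq //;
      exact (Rlt_le_trans _ _ _ Ht2 (Rmin_r _ _)))).
    pose proof (norm_minus_triangle xi (x t) (T t xi)) as H.
    rewrite (norm_minus_sym xi) in H. lra.
Qed.

Context (G : X -> R -> X).
Hypothesis HG : forall xi t, 0 <= t -> j (G xi t) = duhamel Tm1 (fun _ => B (F xi)) t.
Hypothesis HG0 : forall xi eps, 0 < eps ->
  exists d, 0 < d /\ forall t, 0 <= t < d -> norm (G xi t) < eps.

Lemma hold_response_minus (xi eta : X) (t : R) :
  0 <= t -> G (minus xi eta) t = minus (G xi t) (G eta t).
Proof.
  intros Ht. apply Hinj. rewrite (lin_minus j Hj) !HG //.
  rewrite -(duhamel_minus Tm1 HTm1); [|intros; apply continuous_const..|exact Ht].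
  apply duhamel_ext; [exact Ht|]. intros s _. now rewrite (lin_minus F HF) (lin_minus B HB).
Qed.

Lemma hold_response_restart (xi : X) (a b : R) :
  0 <= a -> 0 <= b -> G xi (a + b) = plus (T b (G xi a)) (G xi b).
Proof.
  intros Ha Hb. apply Hinj.
  rewrite (lin_plus j Hj) -Hext // !HG //; [|lra].
  now rewrite (duhamel_restart Tm1 HTm1); [|intros; apply continuous_const| |].
Qed.

Lemma hold_response_at_zero (xi : X) : G xi 0 = zero.
Proof. apply Hinj. rewrite HG; [|lra]. now rewrite duhamel_at_zero (lin_zero j Hj). Qed.

Lemma hold_response_continuous (xi : X) :
  forall t, continuous (fun s => G xi (Rmax 0 s)) t.
Proof.
  apply (continuous_of_increments (G xi) (G xi)).
  - intros a. destruct (sg_bounded T HT a) as (M & HM1 & HM). exists M.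
    split; [exact HM1|]. intros s t Hs Ht.
    replace t with ((t - s) + s) at 1 by ring.
    rewrite hold_response_restart; [|lra|lra].
    rewrite plus_comm minus_plus_cancel. apply HM. lra.
  - apply HG0.
Qed.

(** [fun y => linear_response y h] is the sampled map of the linear periodic loop. *)
Definition linear_response (xi : X) (t : R) : X := plus (T t xi) (G xi t).

(** Through the hold response the equation in [Xm1] becomes a Volterra equation in
    [X].  The function [zc] is a continuous extension of [z] beyond [[0, tau]]. *)
Lemma hold_equation_iff (phi : X -> X) (xi : X) (z zc : R -> X) (tau : R) :
  0 <= tau -> (forall s, continuous (fun s => phi (zc s)) s) ->
  (forall s, 0 <= s <= tau -> z s = zc s) ->
  hold_equation j T Tm1 B F phi xi z tau <->
  zc tau = plus (linear_response xi tau) (duhamel T (fun s => phi (zc s)) tau).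
Proof.
  intros Htau Hzc Hz. rewrite (hold_equation_duhamel phi xi z zc) // -HG //.
  rewrite Hz; [|lra]. rewrite -!(lin_plus j Hj). unfold linear_response.
  rewrite -plus_assoc. split; [apply Hinj|now intros ->].
Qed.

Lemma linear_response_continuous (xi : X) :
  forall t, continuous (fun s => linear_response xi (Rmax 0 s)) t.
Proof.
  intros t. apply (continuous_plus (K := C_AbsRing) (V := X)).
  - now apply sg_continuous.
  - apply hold_response_continuous.
Qed.

Lemma linear_response_at_zero (xi : X) : linear_response xi 0 = xi.
Proof.
  unfold linear_response. now rewrite hold_response_at_zero sg_zero // plus_zero_r.
Qed.

Lemma linear_response_minus (xi eta : X) (t : R) : 0 <= t ->
  linear_response (minus xi eta) t = minus (linear_response xi t) (linear_response eta t).
Proof.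
  intros Ht. unfold linear_response. rewrite hold_response_minus //.
  rewrite (lin_minus (T t)); [|now apply sg_linear]. now rewrite minus_plus_plus.
Qed.

Lemma periodic_solution_iter (x0 : X) (x : R -> X) :
  periodic_solution j T Tm1 B F h x0 x ->
  forall n, x (INR n * h) = Nat.iter n (fun y => linear_response y h) x0.
Proof.
  intros (Hc & H0 & Heq) n. induction n as [|n IH].
  - simpl. now rewrite Rmult_0_l.
  - specialize (Heq n h). rewrite S_INR in Heq.
    specialize (Heq ltac:(lra)).
    apply (hold_equation_iff _ _ _ (fun s => x (INR n * h + s))) in Heq; [|lra| |trivial].
    + rewrite duhamel_zero // in Heq; [|lra]. rewrite plus_zero_r IH in Heq.
      rewrite S_INR Rmult_plus_distr_r Rmult_1_l Heq. reflexivity.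
    + intros s. apply continuous_const.
Qed.

Lemma sampled_map_power_stable : exists Gamma rho, 1 <= Gamma /\ 0 < rho < 1 /\
  forall n xi, norm (Nat.iter n (fun y => linear_response y h) xi) <=
    Gamma * rho ^ n * norm xi.
Proof.
  destruct Hper as (Gamma & gamma & HGamma & Hgamma & Hsol).
  exists Gamma, (exp (- gamma * h)). split; [exact HGamma|]. split.
  - split; [apply exp_pos|]. rewrite -exp_0. apply exp_increasing. nra.
  - intros n xi. destruct (Hsol xi) as (x & Hx & _ & Hdecay).
    rewrite -(periodic_solution_iter xi x Hx n) exp_pow.
    replace (INR n * (- gamma * h)) with (- gamma * (INR n * h)) by ring.
    apply Hdecay. apply Rmult_le_pos; [apply pos_INR|lra].
Qed.

Context (phi : X -> X) (L : R).
Hypothesis HL0 : 0 <= L.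
Hypothesis HL : forall x y, norm (minus (phi x) (phi y)) <= L * norm (minus x y).

Lemma hold_equation_clamp (xi : X) (z : R -> X) (t : R) :
  (forall s, continuous (fun s => z (Rmax 0 s)) s) -> 0 <= t ->
  hold_equation j T Tm1 B F phi xi z t <->
  z t = plus (linear_response xi t) (duhamel T (fun s => phi (z (Rmax 0 s))) t).
Proof.
  intros Hc Ht. rewrite (hold_equation_iff phi xi z (fun s => z (Rmax 0 s))) //.
  - now rewrite (Rmax_right 0 t Ht).
  - exact (lipschitz_continuous phi L _ HL Hc).
  - intros s Hs. now rewrite Rmax_right.
Qed.

Lemma hold_solution_volterra (xi : X) (z : R -> X) (a : R) :
  (forall s, continuous (fun s => z (Rmax 0 s)) s) -> z 0 = xi ->
  (forall t, 0 < t <= a -> hold_equation j T Tm1 B F phi xi z t) ->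
  forall t, 0 <= t <= a ->
    z t = plus (linear_response xi t) (duhamel T (fun s => phi (z (Rmax 0 s))) t).
Proof.
  intros Hc H0 Heq t [[Ht|<-] Hta].
  - apply hold_equation_clamp; [exact Hc|lra|apply Heq; lra].
  - now rewrite H0 duhamel_at_zero linear_response_at_zero plus_zero_r.
Qed.

Lemma hold_solution_unique (xi : X) (z1 z2 : R -> X) (a : R) :
  (forall s, continuous (fun s => z1 (Rmax 0 s)) s) -> z1 0 = xi ->
  (forall t, 0 < t <= a -> hold_equation j T Tm1 B F phi xi z1 t) ->
  (forall s, continuous (fun s => z2 (Rmax 0 s)) s) -> z2 0 = xi ->
  (forall t, 0 < t <= a -> hold_equation j T Tm1 B F phi xi z2 t) ->
  forall t, 0 <= t <= a -> z1 t = z2 t.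
Proof.
  intros Hc1 H01 Heq1 Hc2 H02 Heq2 t Ht.
  rewrite -(Rmax_right 0 t (proj1 Ht)).
  apply (volterra_unique T HT phi L HL0 HL (linear_response xi)
    (fun s => z1 (Rmax 0 s)) (fun s => z2 (Rmax 0 s)) a Hc1 Hc2); [..|exact Ht].
  - intros s Hs. rewrite (Rmax_right 0 s); [|lra].
    now apply (hold_solution_volterra xi z1 a).
  - intros s Hs. rewrite (Rmax_right 0 s); [|lra].
    now apply (hold_solution_volterra xi z2 a).
Qed.

Lemma held_trajectory_volterra (xi : X) (z : R -> X) :
  held_trajectory j T Tm1 B F phi xi z ->
  forall t, 0 <= t ->
    z t = plus (linear_response xi t) (duhamel T (fun s => phi (z (Rmax 0 s))) t).
Proof.
  intros (Hc & H0 & Heq) t Ht. apply (hold_solution_volterra xi z t); [|exact H0| |lra].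
  - now apply continuous_on_nonneg.
  - intros s Hs. apply Heq. lra.
Qed.

Lemma held_trajectory_exists (xi : X) : exists z, held_trajectory j T Tm1 B F phi xi z.
Proof.
  destruct (volterra_exists T HT phi L HL0 HL (linear_response xi)) as (z & Hz & Heq).
  { apply linear_response_continuous. }
  assert (Hc := continuous_clamp z Hz).
  assert (Heq' : forall t, 0 <= t ->
    z t = plus (linear_response xi t) (duhamel T (fun s => phi (z (Rmax 0 s))) t)).
  { intros t Ht. rewrite {1}Heq //. f_equal. apply duhamel_ext; [exact Ht|].
    intros s Hs. now rewrite Rmax_right. }
  exists z. split; [now apply continuous_on_nonneg|split].
  - rewrite Heq; [|lra]. now rewrite duhamel_at_zero linear_response_at_zero plus_zero_r.
  - intros t Ht. apply hold_equation_clamp; [exact Hc|lra|]. apply Heq'. lra.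
Qed.

(** The input stays [F xi] after the restart at time [a], whereas the state is [z a]:
    the mismatch between [xi] and [z a] is the sampling error. *)
Lemma held_trajectory_restart (xi : X) (z : R -> X) (a b : R) :
  held_trajectory j T Tm1 B F phi xi z -> 0 <= a -> 0 <= b ->
  z (a + b) = plus (plus (T b (z a)) (G xi b))
    (duhamel T (fun s => phi (z (Rmax 0 (a + s)))) b).
Proof.
  intros Hz Ha Hb.
  assert (Hc := proj1 (continuous_on_nonneg z) (proj1 Hz)).
  rewrite (held_trajectory_volterra xi z Hz (a + b)); [|lra].
  rewrite (held_trajectory_volterra xi z Hz a Ha).
  rewrite (duhamel_restart T HT) //; [|exact (lipschitz_continuous phi L _ HL Hc)].
  unfold linear_response. rewrite (Rplus_comm a b) (sg_add T HT) // (Rplus_comm b a).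
  rewrite hold_response_restart // !(lin_plus (T b) (sg_linear T HT b Hb)).
  rewrite !plus_assoc. f_equal. now rewrite plus_swap_r.
Qed.

Context (M K : R).
Hypothesis HM1 : 1 <= M.
Hypothesis HM : forall t x, 0 <= t <= h -> norm (T t x) <= M * norm x.
Hypothesis HK0 : 0 <= K.
Hypothesis HK : forall xi t, 0 <= t <= h -> norm (G xi t) <= K * norm xi.
Hypothesis HL1 : L <= 1.
Hypothesis Hphi0 : phi zero = zero.

Lemma lipschitz_norm_le (x : X) : norm (phi x) <= L * norm x.
Proof.
  pose proof (HL x zero) as H. rewrite Hphi0 in H.
  assert (E : forall y : X, minus y zero = y).
  { intros y. rewrite -{2}(minus_plus_cancel zero y). now rewrite plus_zero_l. }
  now rewrite !E in H.
Qed.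

(** As [L <= 1], the weight [2 * M] is admissible in Gronwall's inequality, and the
    constants do not involve [L]. *)
Lemma held_trajectory_growth (xi : X) (z : R -> X) (a : R) :
  held_trajectory j T Tm1 B F phi xi z -> 0 <= a -> norm xi <= 2 * norm (z a) ->
  forall b, 0 <= b <= h ->
    norm (z (a + b)) <= 2 * ((M + 2 * K) * norm (z a)) * exp (2 * M * b).
Proof.
  intros Hz Ha Hxi b Hb.
  assert (Hc := proj1 (continuous_on_nonneg z) (proj1 Hz)).
  assert (Hc' := continuous_shift (fun s => z (Rmax 0 s)) a Hc).
  rewrite -(Rmax_right 0 (a + b)); [|lra].
  apply (volterra_bound T HT (fun s => z (Rmax 0 (a + s)))
    (fun s => phi (z (Rmax 0 (a + s)))) h M L); try assumption; try lra; try nra.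
  - pose proof (norm_ge_0 (z a)). nra.
  - exact (lipschitz_continuous phi L _ HL Hc').
  - intros s Hs. apply lipschitz_norm_le.
  - intros s Hs. rewrite Rmax_right; [|lra].
    rewrite (held_trajectory_restart xi z a s); [|exact Hz|lra|lra].
    eapply Rle_trans; [apply: norm_triangle|]. apply Rplus_le_compat_r.
    eapply Rle_trans; [apply: norm_triangle|].
    specialize (HM s (z a) Hs). specialize (HK xi s Hs).
    change (norm (T s (z a)) + norm (G xi s) <= (M + 2 * K) * norm (z a)). nra.
Qed.

(** Replacing the held state [xi] by the current state [z a] costs [G (xi - z a) h],
    which is small as long as no event is detected. *)
Lemma held_trajectory_step (xi : X) (z : R -> X) (a eps : R) :
  held_trajectory j T Tm1 B F phi xi z -> 0 <= a -> 0 <= eps ->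
  norm xi <= 2 * norm (z a) -> norm (minus (z a) xi) <= eps * norm xi ->
  norm (minus (z (a + h)) (linear_response (z a) h)) <=
    (2 * K * eps + L * ((M + 2 * K) * exp (2 * M * h))) * norm (z a).
Proof.
  intros Hz Ha Heps Hxi Hdiff.
  assert (Hc := proj1 (continuous_on_nonneg z) (proj1 Hz)).
  assert (Hc' := continuous_shift (fun s => z (Rmax 0 s)) a Hc).
  rewrite (held_trajectory_restart xi z a h Hz Ha); [|lra].
  set (d := duhamel _ _ h). unfold linear_response.
  assert (E : minus (plus (plus (T h (z a)) (G xi h)) d) (plus (T h (z a)) (G (z a) h))
    = plus (G (minus xi (z a)) h) d).
  { rewrite -plus_assoc minus_plus_l hold_response_minus; [|lra].
    unfold minus. rewrite -!plus_assoc. f_equal. apply plus_comm. }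
  rewrite E. eapply Rle_trans; [apply: norm_triangle|].
  change (norm (G (minus xi (z a)) h) + norm d <=
    (2 * K * eps + L * ((M + 2 * K) * exp (2 * M * h))) * norm (z a)).
  assert (H1 : norm (G (minus xi (z a)) h) <= 2 * K * eps * norm (z a)).
  { eapply Rle_trans; [apply HK; lra|]. rewrite norm_minus_sym.
    apply Rle_trans with (K * (eps * norm xi)).
    - now apply Rmult_le_compat_l.
    - assert (0 <= K * eps) by now apply Rmult_le_pos. nra. }
  assert (H2 : norm d <= M * (L * (2 * ((M + 2 * K) * norm (z a)))) / (2 * M) *
    exp (2 * M * h)).
  { apply (duhamel_exp_bound T HT _ h); try assumption; try lra.
    - exact (lipschitz_continuous phi L _ HL Hc').
    - apply Rmult_le_pos; [exact HL0|]. pose proof (norm_ge_0 (z a)). nra.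
    - intros s Hs. eapply Rle_trans; [apply lipschitz_norm_le|].
      rewrite Rmult_assoc. apply Rmult_le_compat_l; [exact HL0|].
      rewrite Rmax_right; [|lra]. now apply (held_trajectory_growth xi). }
  replace (M * (L * (2 * ((M + 2 * K) * norm (z a)))) / (2 * M) * exp (2 * M * h)) with
    (L * ((M + 2 * K) * exp (2 * M * h)) * norm (z a)) in H2 by (field; lra).
  lra.
Qed.

End HeldInput.

(** * Update times and concatenated trajectories *)

Section Schedule.

Context (h : R) (N : nat -> nat).
Hypothesis Hh : 0 < h.
Hypothesis HN0 : N 0%nat = 0%nat.
Hypothesis HN : forall k, (N k < N (S k))%nat.

Lemma schedule_monotone (k m : nat) : (k <= m)%nat -> (N k <= N m)%nat.
Proof.
  intros H. induction H as [|m H IH]; [lia|]. specialize (HN m). lia.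
Qed.

Lemma schedule_bracket (n : nat) : exists k, (N k <= n < N (S k))%nat.
Proof.
  induction n as [|n [k Hk]].
  - exists 0%nat. specialize (HN 0%nat). lia.
  - destruct (Nat.eq_dec (S n) (N (S k))) as [E|E].
    + exists (S k). specialize (HN (S k)). lia.
    + exists k. lia.
Qed.

Lemma grid_bracket (t : R) : 0 <= t -> exists n, INR n * h <= t < INR (S n) * h.
Proof.
  intros Ht. destruct (nfloor_ex (t / h)) as [n [Hn1 Hn2]].
  { apply Rmult_le_pos; [exact Ht|now apply Rlt_le, Rinv_0_lt_compat]. }
  exists n. rewrite S_INR.
  apply Rmult_le_compat_r with (r := h) in Hn1; [|lra].
  apply Rmult_lt_compat_r with (r := h) in Hn2; [|lra].
  replace (t / h * h) with t in Hn1, Hn2 by (field; lra). lra.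
Qed.

Lemma grid_le (n m : nat) : (n <= m)%nat -> INR n * h <= INR m * h.
Proof. intros H. apply Rmult_le_compat_r; [lra|now apply le_INR]. Qed.

Lemma grid_lt (n m : nat) : (n < m)%nat -> INR n * h < INR m * h.
Proof. intros H. apply Rmult_lt_compat_r; [lra|now apply lt_INR]. Qed.

Lemma grid_lt_inv (n m : nat) : INR n * h < INR m * h -> (n < m)%nat.
Proof. intros H. apply INR_lt. now apply Rmult_lt_reg_r in H. Qed.

Lemma schedule_bracket_real (t : R) :
  0 <= t -> exists k, INR (N k) * h <= t < INR (N (S k)) * h.
Proof.
  intros Ht. destruct (grid_bracket t Ht) as [n Hn].
  destruct (schedule_bracket n) as [k Hk]. exists k.
  pose proof (grid_le (N k) n ltac:(lia)). pose proof (grid_le (S n) (N (S k)) ltac:(lia)).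
  lra.
Qed.

(** Neighbouring pieces agree at the switching times, and these tend to infinity. *)
Lemma concatenation {V : CompleteNormedModule C_AbsRing} (Z : nat -> R -> V) :
  (forall k, continuous_on (fun s => 0 <= s) (Z k)) ->
  (forall k, Z (S k) 0 = Z k (INR (N (S k)) * h - INR (N k) * h)) ->
  exists x, continuous_on (fun s => 0 <= s) x /\
    forall k t, INR (N k) * h <= t <= INR (N (S k)) * h -> x t = Z k (t - INR (N k) * h).
Proof.
  intros Hc Hglue.
  assert (Hx : exists x : R -> V, forall t k,
    INR (N k) * h <= t <= INR (N (S k)) * h -> x t = Z k (t - INR (N k) * h)).
  { apply (functional_choice (fun t v => forall k,
      INR (N k) * h <= t <= INR (N (S k)) * h -> v = Z k (t - INR (N k) * h))).
    intros t. destruct (Rle_dec 0 t) as [Ht|Ht].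
    - destruct (schedule_bracket_real t Ht) as [m Hm].
      exists (Z m (t - INR (N m) * h)). intros k Hk.
      destruct (Nat.lt_trichotomy k m) as [Hkm|[->|Hkm]]; [|reflexivity|].
      + destruct (Nat.eq_dec (S k) m) as [<-|Hne].
        * replace t with (INR (N (S k)) * h) by lra. rewrite Rminus_diag. apply Hglue.
        * pose proof (grid_lt _ _ (HN (S k))).
          pose proof (grid_le _ _ (schedule_monotone (S (S k)) m ltac:(lia))). lra.
      + pose proof (grid_le _ _ (schedule_monotone (S m) k ltac:(lia))). lra.
    - exists zero. intros k Hk. pose proof (pos_INR (N k)). nra. }
  destruct Hx as [x Hx]. exists x. split; [|intros k t; apply Hx].
  assert (Hpiece : forall k t eps, 0 < eps -> INR (N k) * h <= t <= INR (N (S k)) * h ->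
    exists d, 0 < d /\ forall s, INR (N k) * h <= s <= INR (N (S k)) * h ->
      Rabs (s - t) < d -> norm (minus (x s) (x t)) < eps).
  { intros k t eps He Ht. specialize (Hc k (t - INR (N k) * h) ltac:(lra)).
    rewrite filterlim_norm_iff in Hc. destruct (Hc eps He) as [d Hd].
    exists d. split; [apply cond_pos|]. intros s Hs Hst.
    rewrite (Hx s k Hs) (Hx t k Ht). apply Hd; [|lra].
    change (Rabs (s - INR (N k) * h - (t - INR (N k) * h)) < d).
    now replace (s - INR (N k) * h - (t - INR (N k) * h)) with (s - t) by ring. }
  intros t Ht. apply filterlim_norm_iff; [apply within_filter, locally_filter|].
  intros eps He. destruct (schedule_bracket_real t Ht) as [k Hk].
  destruct (Hpiece k t eps He ltac:(lra)) as (d & Hd & Hright).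
  destruct (proj1 Hk) as [Hlt|Heq].
  - assert (Hd' : 0 < Rmin d (Rmin (t - INR (N k) * h) (INR (N (S k)) * h - t)))
      by (repeat apply Rmin_pos; lra).
    exists (mkposreal _ Hd'). intros s Hs _. change (Rabs (s - t) < Rmin d
      (Rmin (t - INR (N k) * h) (INR (N (S k)) * h - t))) in Hs.
    pose proof (Rlt_le_trans _ _ _ Hs (Rmin_r _ _)) as Hs'.
    pose proof (Rlt_le_trans _ _ _ Hs' (Rmin_l _ _)) as H1.
    pose proof (Rlt_le_trans _ _ _ Hs' (Rmin_r _ _)) as H2.
    apply Hright; [|exact (Rlt_le_trans _ _ _ Hs (Rmin_l _ _))].
    apply Rabs_def2 in H1. apply Rabs_def2 in H2. lra.
  - (* At a switching time the left neighbours belong to the previous piece. *)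
    assert (Hleft : exists d, 0 < d /\ forall s, 0 <= s <= t -> Rabs (s - t) < d ->
      norm (minus (x s) (x t)) < eps).
    { destruct k as [|k].
      - exists 1. split; [lra|]. intros s Hs _. rewrite HN0 Rmult_0_l in Heq.
        replace s with t by lra. now rewrite minus_eq_zero norm_zero.
      - pose proof (grid_lt _ _ (HN k)).
        destruct (Hpiece k t eps He ltac:(lra)) as (d' & Hd' & Hl).
        exists (Rmin d' (t - INR (N k) * h)). split; [apply Rmin_pos; lra|].
        intros s Hs Hst. apply Hl; [|exact (Rlt_le_trans _ _ _ Hst (Rmin_l _ _))].
        pose proof (Rlt_le_trans _ _ _ Hst (Rmin_r _ _)) as H1.
        apply Rabs_def2 in H1. lra. }
    destruct Hleft as (d' & Hd' & Hleft).
    assert (Hdd : 0 < Rmin (Rmin d d') (INR (N (S k)) * h - t))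
      by (repeat apply Rmin_pos; lra).
    exists (mkposreal _ Hdd). intros s Hs Hs0.
    change (Rabs (s - t) < Rmin (Rmin d d') (INR (N (S k)) * h - t)) in Hs.
    pose proof (Rlt_le_trans _ _ _ Hs (Rmin_r _ _)) as H1.
    pose proof (Rlt_le_trans _ _ _ Hs (Rmin_l _ _)) as H2.
    destruct (Rle_dec s t).
    + apply Hleft; [lra|exact (Rlt_le_trans _ _ _ H2 (Rmin_r _ _))].
    + apply Rabs_def2 in H1.
      apply Hright; [lra|exact (Rlt_le_trans _ _ _ H2 (Rmin_l _ _))].
Qed.

End Schedule.

Lemma continuous_on_shift {V : CompleteNormedModule C_AbsRing} (x : R -> V) (a : R) :
  continuous_on (fun s => 0 <= s) x -> 0 <= a ->
  forall s, continuous (fun s => x (a + Rmax 0 s)) s.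
Proof.
  intros Hx Ha s. apply (continuous_ext (fun s => x (Rmax 0 (a + Rmax 0 s)))).
  - intros r. rewrite (Rmax_right 0 (a + _)) //. pose proof (Rmax_l 0 r). lra.
  - apply (continuous_clamp (fun r => x (Rmax 0 (a + r)))).
    apply (continuous_shift (fun r => x (Rmax 0 r))).
    now apply continuous_on_nonneg.
Qed.

Lemma is_min_unique (E1 E2 : R -> Prop) (m1 m2 : Rbar) :
  (forall s, E1 s <-> E2 s) -> is_min E1 m1 -> is_min E2 m2 -> m1 = m2.
Proof.
  intros HE. destruct m1 as [r1| |], m2 as [r2| |]; simpl; try tauto.
  - intros [H1 H1'] [H2 H2']. f_equal.
    apply Rle_antisym; [apply H1'|apply H2']; now apply HE.
  - intros [H1 _] H2. destruct (H2 r1). now apply HE.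
  - intros H1 [H2 _]. destruct (H1 r2). now apply HE.
Qed.

Section EventTriggered.

Context {X U Xm1 : CompleteNormedModule C_AbsRing}.
Context (j : X -> Xm1) (T : R -> X -> X) (Tm1 : R -> Xm1 -> Xm1).
Context (B : U -> Xm1) (F : X -> U) (phi : X -> X).

Notation hold := (hold_equation j T Tm1 B F phi).
Notation held := (held_trajectory j T Tm1 B F phi).

Lemma hold_equation_ext (xi : X) (z1 z2 : R -> X) (tau : R) :
  0 <= tau -> (forall s, 0 <= s <= tau -> z1 s = z2 s) ->
  hold xi z1 tau -> hold xi z2 tau.
Proof.
  intros Htau Hz (I & HI & HE). exists I. rewrite -(Hz tau); [|lra]. split; [|exact HE].
  eapply (@is_RInt_ext (real_restriction Xm1)); [|exact HI].
  intros s Hs. rewrite Rmin_left // Rmax_right // in Hs. cbv beta. rewrite (Hz s); [reflexivity|lra].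
Qed.

Hypothesis Hexists : forall xi, exists z, held xi z.
Hypothesis Hunique : forall xi z1 z2 a,
  (forall s, continuous (fun s => z1 (Rmax 0 s)) s) -> z1 0 = xi ->
  (forall t, 0 < t <= a -> hold xi z1 t) ->
  (forall s, continuous (fun s => z2 (Rmax 0 s)) s) -> z2 0 = xi ->
  (forall t, 0 < t <= a -> hold xi z2 t) ->
  forall t, 0 <= t <= a -> z1 t = z2 t.

Lemma held_unique (xi : X) (z1 z2 : R -> X) :
  held xi z1 -> held xi z2 -> forall t, 0 <= t -> z1 t = z2 t.
Proof.
  intros (Hc1 & H01 & Heq1) (Hc2 & H02 & Heq2) t Ht.
  apply (Hunique xi z1 z2 t); try assumption; try lra;
    try (now apply continuous_on_nonneg).
  - intros s Hs. apply Heq1. lra.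
  - intros s Hs. apply Heq2. lra.
Qed.

Context (h eps : R) (lmax : nat).
Hypothesis Hh : 0 < h.
Hypothesis Heps : 0 <= eps.
Hypothesis Hlmax : (1 <= lmax)%nat.

Definition next_update (xi : X) (tk t' : R) : Prop :=
  exists (z : R -> X) (tbar : Rbar), held xi z /\
    is_min (event_times h eps tk z) tbar /\
    Finite t' = Rbar_min (Finite (tk + INR lmax * h)) tbar.

Lemma event_times_ext (xi : X) (z1 z2 : R -> X) (tk s : R) :
  held xi z1 -> held xi z2 -> event_times h eps tk z1 s -> event_times h eps tk z2 s.
Proof.
  intros H1 H2 (l & Hl & Hs & Htk & Hev). exists l. do 3 (split; [assumption|]).
  rewrite -!(held_unique xi z1 z2 H1 H2) //; lra.
Qed.

Lemma next_update_unique (xi : X) (tk t1 t2 : R) :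
  next_update xi tk t1 -> next_update xi tk t2 -> t1 = t2.
Proof.
  intros (z1 & b1 & Hz1 & Hb1 & E1) (z2 & b2 & Hz2 & Hb2 & E2).
  assert (b1 = b2) as ->.
  { eapply is_min_unique; [|exact Hb1|exact Hb2].
    intros s. split; now apply (event_times_ext xi). }
  rewrite -E2 in E1. now injection E1.
Qed.

(** Events occur at multiples of [h] only, so the first one exists by well-ordering. *)
Lemma next_update_exists (xi : X) (n : nat) :
  exists n', next_update xi (INR n * h) (INR n' * h).
Proof.
  destruct (Hexists xi) as [z Hz].
  set (E := event_times h eps (INR n * h) z).
  destruct (classic (exists l, E (INR l * h))) as [Hev|Hev].
  - destruct (Wf_nat.dec_inh_nat_subset_has_unique_least_element
      (fun l => E (INR l * h)) (fun l => classic _) Hev) as (l & [Hl Hmin] & _).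
    exists (Nat.min (n + lmax) l), z, (Finite (INR l * h)).
    split; [exact Hz|]. split.
    + split; [exact Hl|]. intros s Hs. pose proof Hs as (l' & _ & -> & _).
      apply grid_le; [exact Hh|]. now apply Hmin.
    + simpl. f_equal. rewrite -Rmult_plus_distr_r -plus_INR.
      destruct (Nat.le_ge_cases (n + lmax) l) as [H|H].
      * rewrite Nat.min_l // Rmin_left //. now apply grid_le.
      * rewrite Nat.min_r // Rmin_right //. now apply grid_le.
  - exists (n + lmax)%nat, z, p_infty. split; [exact Hz|]. split.
    + intros s Hs. apply Hev. pose proof Hs as (l & _ & -> & _). now exists l.
    + simpl. f_equal. rewrite plus_INR. ring.
Qed.

(** Before the next update the state stays within the relative distance [eps] of the
    held state at the sampling times, as otherwise an event would have been detected. *)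
Lemma next_update_spec (xi : X) (z : R -> X) (n : nat) (t' : R) :
  held xi z -> next_update xi (INR n * h) t' ->
  exists n', t' = INR n' * h /\ (n < n')%nat /\
    forall m, (n <= m < n')%nat ->
      norm (minus (z (INR m * h - INR n * h)) xi) <= eps * norm xi.
Proof.
  intros Hz (z' & tbar & Hz' & Hmin & E).
  assert (Hz0 : z 0 = xi) by apply Hz.
  assert (Hquiet : forall m, (n <= m)%nat -> Rbar_lt (INR m * h) tbar ->
    norm (minus (z (INR m * h - INR n * h)) xi) <= eps * norm xi).
  { intros m Hm Hlt. apply Rnot_lt_le. intros Hev.
    destruct (Nat.eq_dec n m) as [<-|Hne].
    - rewrite Rminus_diag Hz0 minus_eq_zero norm_zero in Hev.
      pose proof (Rmult_le_pos _ _ Heps (norm_ge_0 xi)). lra.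
    - assert (H : event_times h eps (INR n * h) z' (INR m * h)).
      { apply (event_times_ext xi z); [exact Hz|exact Hz'|].
        exists m. split; [lia|]. split; [reflexivity|].
        split; [apply grid_lt; [exact Hh|lia]|]. now rewrite Hz0. }
      destruct tbar as [r| |]; simpl in Hmin, Hlt.
      + apply Hmin in H. lra.
      + now apply Hmin in H.
      + exact Hlt. }
  assert (Hn' : exists n', t' = INR n' * h /\ (n < n')%nat /\ Rbar_le t' tbar).
  { rewrite -Rmult_plus_distr_r -plus_INR in E.
    destruct tbar as [r| |]; simpl in Hmin, E; [|injection E as ->|easy].
    - injection E as ->. destruct Hmin as [(l & _ & -> & Hl & _) _].
      unfold Rmin. destruct Rle_dec as [H|H].
      + exists (n + lmax)%nat. split; [reflexivity|]. split; [lia|exact H].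
      + exists l. split; [reflexivity|]. split; [now apply (grid_lt_inv h Hh)|].
        apply Rle_refl.
    - exists (n + lmax)%nat. split; [reflexivity|]. split; [lia|exact I]. }
  destruct Hn' as (n' & -> & Hnn' & Hle). exists n'. split; [reflexivity|].
  split; [exact Hnn'|]. intros m Hm. apply Hquiet; [lia|].
  eapply Rbar_lt_le_trans; [|exact Hle]. apply grid_lt; [exact Hh|lia].
Qed.

Lemma event_triggered_grid (x : R -> X) (t : nat -> R) :
  event_triggered j T Tm1 B F phi h eps lmax x t ->
  forall k, exists n, t k = INR n * h /\ (k <= n)%nat.
Proof.
  intros [H0 Hstep] k. induction k as [|k (n & Hn & Hkn)].
  - exists 0%nat. rewrite H0. simpl. split; [ring|lia].
  - pose proof (Hstep k) as Hk. rewrite Hn in Hk.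
    destruct (Hexists (x (INR n * h))) as [z Hz].
    destruct (next_update_spec _ z n _ Hz Hk) as (n' & -> & Hn' & _).
    exists n'. split; [reflexivity|lia].
Qed.

Lemma event_triggered_solution_unique (x0 : X) (x y : R -> X) :
  event_triggered_solution j T Tm1 B F phi h eps lmax x0 x ->
  event_triggered_solution j T Tm1 B F phi h eps lmax x0 y ->
  forall s, 0 <= s -> y s = x s.
Proof.
  intros (t & Ht & Hcx & Hx0 & Hx) (r & Hr & Hcy & Hy0 & Hy).
  assert (H : forall k, t k = r k /\ forall s, 0 <= s <= t k -> y s = x s).
  { induction k as [|k [IHt IHx]].
    - rewrite (proj1 Ht) (proj1 Hr). split; [reflexivity|].
      intros s Hs. replace s with 0 by lra. now rewrite Hx0 Hy0.
    - destruct (event_triggered_grid x t Ht k) as (n & Hn & _).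
      assert (Htk : 0 <= t k).
      { rewrite Hn. apply Rmult_le_pos; [apply pos_INR|lra]. }
      assert (Hxy : y (t k) = x (t k)) by (apply IHx; lra).
      assert (HtS : t (S k) = r (S k)).
      { apply (next_update_unique (x (t k)) (t k)); [apply Ht|].
        pose proof (proj2 Hr k) as Hrk. rewrite -IHt Hxy in Hrk. exact Hrk. }
      split; [exact HtS|]. intros s Hs.
      destruct (Rle_dec s (t k)) as [Hsk|Hsk]; [apply IHx; lra|].
      replace s with (t k + (s - t k)) by ring.
      apply (Hunique (x (t k)) (fun s => y (t k + s)) (fun s => x (t k + s))
        (t (S k) - t k)); [..|lra].
      + now apply continuous_on_shift.
      + now rewrite Rplus_0_r.
      + intros tau Htau. rewrite -Hxy IHt. apply Hy. rewrite -IHt -HtS. exact Htau.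
      + now apply continuous_on_shift.
      + now rewrite Rplus_0_r.
      + apply Hx. }
  intros s Hs. destruct (grid_bracket h Hh s Hs) as [n Hn].
  destruct (event_triggered_grid x t Ht (S n)) as (m & Hm & Hnm).
  apply (H (S n)). rewrite Hm. pose proof (grid_le h Hh _ _ Hnm). lra.
Qed.

Lemma update_sequence_exists (x0 : X) :
  exists (N : nat -> nat) (xi : nat -> X) (Z : nat -> R -> X),
    N 0%nat = 0%nat /\ xi 0%nat = x0 /\ forall k, held (xi k) (Z k) /\
      next_update (xi k) (INR (N k) * h) (INR (N (S k)) * h) /\
      xi (S k) = Z k (INR (N (S k)) * h - INR (N k) * h).
Proof.
  destruct (functional_choice _ Hexists) as [traj Htraj].
  destruct (functional_choice (fun (p : nat * X) n' =>
    next_update (snd p) (INR (fst p) * h) (INR n' * h))) as [next Hnext].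
  { intros [n xi]. apply next_update_exists. }
  pose (state := nat_rect (fun _ => (nat * X)%type) (0%nat, x0)
    (fun _ p => (next p, traj (snd p) (INR (next p) * h - INR (fst p) * h)))).
  exists (fun k => fst (state k)), (fun k => snd (state k)), (fun k => traj (snd (state k))).
  split; [reflexivity|]. split; [reflexivity|].
  intros k. split; [apply Htraj|]. split; [apply (Hnext (state k))|reflexivity].
Qed.

(** The last clause is all that the decay estimate uses: every sampling interval lies in
    a single holding interval, and at its start the sampling error is below the
    threshold. *)
Lemma event_triggered_solution_exists (x0 : X) : exists x,
  event_triggered_solution j T Tm1 B F phi h eps lmax x0 x /\ x 0 = x0 /\
  forall n, exists xi z a, held xi z /\ 0 <= a /\
    norm (minus (z a) xi) <= eps * norm xi /\
    forall b, 0 <= b <= h -> x (INR n * h + b) = z (a + b).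
Proof.
  destruct (update_sequence_exists x0) as (N & xi & Z & HN0 & Hxi0 & HZ).
  assert (Hspec : forall k, (N k < N (S k))%nat /\
    forall m, (N k <= m < N (S k))%nat ->
      norm (minus (Z k (INR m * h - INR (N k) * h)) (xi k)) <= eps * norm (xi k)).
  { intros k. destruct (HZ k) as (Hk & Hnext & _).
    destruct (next_update_spec _ _ _ _ Hk Hnext) as (n' & E & Hn' & Hq).
    replace (N (S k)) with n'; [now split|].
    apply Rmult_eq_reg_r in E; [|lra]. now apply INR_eq. }
  assert (HN := fun k => proj1 (Hspec k)).
  assert (HZ0 : forall k, Z k 0 = xi k) by (intros k; apply HZ).
  destruct (concatenation h N Hh HN0 HN Z) as (x & Hc & Hx).
  { intros k. apply HZ. }
  { intros k. rewrite HZ0. apply HZ. }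
  assert (Hxk : forall k, x (INR (N k) * h) = xi k).
  { intros k. pose proof (grid_lt h Hh _ _ (HN k)).
    rewrite (Hx k); [|lra]. now rewrite Rminus_diag. }
  assert (H0 : x 0 = x0).
  { rewrite -Hxi0 -Hxk HN0. f_equal. simpl. ring. }
  exists x. split; [|split; [exact H0|]].
  - exists (fun k => INR (N k) * h). split.
    + split; [rewrite HN0; simpl; ring|]. intros k. rewrite Hxk.
      destruct (HZ k) as (_ & Hnext & _). exact Hnext.
    + split; [exact Hc|split; [exact H0|]]. intros k tau Htau. rewrite Hxk.
      apply (hold_equation_ext _ (Z k)).
      * lra.
      * intros s Hs. rewrite (Hx k); [|lra]. f_equal. ring.
      * apply HZ. lra.
  - intros n. destruct (schedule_bracket N HN0 HN n) as [k Hk].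
    exists (xi k), (Z k), (INR n * h - INR (N k) * h).
    split; [apply HZ|]. split; [|split; [apply Hspec; exact Hk|]].
    + pose proof (grid_le h Hh (N k) n ltac:(lia)). lra.
    + intros b Hb.
      pose proof (grid_le h Hh (N k) n ltac:(lia)).
      pose proof (grid_le h Hh (S n) (N (S k)) ltac:(lia)) as H1. rewrite S_INR in H1.
      rewrite (Hx k); [|lra]. f_equal. ring.
Qed.

End EventTriggered.

(** * Perturbed power-stable recursions *)

(** It is the estimate of [Nat.iter m D (y n)] for all [m] at once that propagates in
    [n]; equivalently, [D] contracts the supremum over [m] of
    [norm (Nat.iter m D x) / rho ^ m], an equivalent norm. *)
Lemma perturbed_power_stable {V : CompleteNormedModule C_AbsRing} (D : V -> V)
    (Gamma rho delta : R) (y : nat -> V) :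
  (forall x1 x2, D (minus x1 x2) = minus (D x1) (D x2)) ->
  0 <= Gamma -> 0 <= rho -> 0 <= delta ->
  (forall n x, norm (Nat.iter n D x) <= Gamma * rho ^ n * norm x) ->
  (forall n, norm (minus (y (S n)) (D (y n))) <= delta * norm (y n)) ->
  forall n, norm (y n) <= Gamma * (rho + Gamma * delta) ^ n * norm (y 0%nat).
Proof.
  intros HD HG Hrho Hdelta Hpow Hy n. set (q := rho + Gamma * delta).
  assert (Hiter : forall m x1 x2,
    Nat.iter m D (minus x1 x2) = minus (Nat.iter m D x1) (Nat.iter m D x2)).
  { intros m x1 x2. induction m as [|m IH]; [reflexivity|]. simpl. now rewrite IH HD. }
  assert (H : forall m, norm (Nat.iter m D (y n)) <=
    Gamma * rho ^ m * (q ^ n * norm (y 0%nat))).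
  { induction n as [|n IH]; intros m.
    - rewrite pow_O Rmult_1_l. apply Hpow.
    - eapply Rle_trans; [apply (norm_le_norm_minus (Nat.iter m D (D (y n))))|].
      rewrite -Hiter -Nat.iter_succ_r.
      pose proof (IH (S m)) as H1. pose proof (IH 0%nat) as H0.
      pose proof (Hpow m (minus (y (S n)) (D (y n)))) as H2. specialize (Hy n).
      simpl in H0. rewrite Rmult_1_r in H0. rewrite -!tech_pow_Rmult in H1 |- *.
      set (w := q ^ n * norm (y 0%nat)) in *.
      assert (H3 : norm (minus (y (S n)) (D (y n))) <= delta * (Gamma * w)).
      { eapply Rle_trans; [exact Hy|]. now apply Rmult_le_compat_l. }
      assert (H4 : 0 <= Gamma * rho ^ m)
        by (apply Rmult_le_pos; [exact HG|now apply pow_le]).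
      apply Rmult_le_compat_l with (r := Gamma * rho ^ m) in H3; [|exact H4].
      replace (Gamma * rho ^ m * (q * q ^ n * norm (y 0%nat))) with
        (Gamma * (rho * rho ^ m) * w + Gamma * rho ^ m * (delta * (Gamma * w)))
        by (unfold w, q; ring).
      lra. }
  specialize (H 0%nat). simpl in H. lra.
Qed.

(** A time in [[n * h, (n + 1) * h]] may exceed [n * h] by [h], which costs the factor
    [/ q]. *)
Lemma sampled_decay (f : R -> R) (h q A : R) :
  0 < h -> 0 < q < 1 -> 0 <= A ->
  (forall n b, 0 <= b <= h -> f (INR n * h + b) <= A * q ^ n) ->
  forall t, 0 <= t -> f t <= A / q * exp (- (- ln q / h) * t).
Proof.
  intros Hh Hq HA Hf t Ht. destruct (grid_bracket h Hh t Ht) as [n Hn].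
  replace t with (INR n * h + (t - INR n * h)) at 1 by ring.
  eapply Rle_trans; [apply Hf; rewrite S_INR in Hn; lra|].
  assert (Hln : ln q < 0) by (rewrite -ln_1; apply ln_increasing; lra).
  assert (Hpow : q ^ S n <= exp (- (- ln q / h) * t)).
  { rewrite -{1}(exp_ln q) ?exp_pow; [|lra]. apply exp_monotone.
    replace (INR (S n) * ln q) with (- (- ln q / h) * (INR (S n) * h)) by (field; lra).
    assert (0 < - ln q / h) by (apply Rdiv_lt_0_compat; lra). nra. }
  apply Rle_trans with (A / q * q ^ S n).
  - apply Req_le. simpl. field. lra.
  - apply Rmult_le_compat_l; [|exact Hpow].
    apply Rmult_le_pos; [exact HA|]. apply Rlt_le, Rinv_0_lt_compat. lra.
Qed.

(** * Exponential stability of the event-triggered loop *)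

Theorem theorem4p7
  (X U Xm1 : CompleteNormedModule C_AbsRing)
  (hX : is_hilbert X) (hU : is_hilbert U)
  (A : X -> X -> Prop) (T : R -> X -> X)
  (hA : generates A T) (hT : analytic_semigroup T)
  (lambda : C) (Rl : X -> X) (hRl : is_resolvent A lambda Rl)
  (j : X -> Xm1) (hj : is_extrapolation_space Rl j)
  (Tm1 : R -> Xm1 -> Xm1) (hTm1 : is_extended_semigroup j T Tm1)
  (B : U -> Xm1) (hB : is_linear B)
  (F : X -> U) (hF : compact_operator F)
  (hABF : exists V : R -> X -> X,
     generates (A_BF j Tm1 B F) V /\ exp_stable_semigroup V)
  (h : R) (hh : 0 < h)
  (hper : exp_stable_system (periodic_solution j T Tm1 B F h)) :
  exists eps_star L_star : R, 0 < eps_star /\ 0 < L_star /\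
    forall (eps L : R) (phi : X -> X) (lmax : nat),
      0 <= eps <= eps_star ->
      0 <= L <= L_star ->
      phi zero = zero ->
      (forall xi1 xi2 : X,
         norm (minus (phi xi1) (phi xi2)) <= L * norm (minus xi1 xi2)) ->
      (1 <= lmax)%nat ->
      exp_stable_system (event_triggered_solution j T Tm1 B F phi h eps lmax).
Proof.
  assert (HT : c0_semigroup T) by apply hA.
  destruct hTm1 as [HTm1 Hext]. assert (Hj : is_linear j) by apply hj.
  assert (HF : is_linear F) by apply hF.
  assert (Hinj := extrapolation_injective A T lambda Rl j hA hRl hj).
  destruct (hold_response_exists j T Tm1 B F HT HTm1 Hext Hj Hinj h hh hper)
    as (G & K & HK0 & HG & HK & HG0).
  destruct (sampled_map_power_stable j T Tm1 B F HT HTm1 Hext Hj Hinj h hh hper G HG)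
    as (Gamma & rho & HGamma & Hrho & Hpow).
  destruct (sg_bounded T HT h) as (M & HM1 & HM).
  set (Cg := (M + 2 * K) * exp (2 * M * h)).
  assert (HCg : 1 <= Cg).
  { assert (1 <= exp (2 * M * h)).
    { rewrite -{1}exp_0. apply exp_monotone. nra. }
    unfold Cg. nra. }
  (* Any [delta] with [rho + Gamma * delta < 1] would do; this one yields the
     midpoint of [rho] and [1]. *)
  set (delta := (1 - rho) / (2 * Gamma)).
  assert (Hdelta : 0 < delta) by (apply Rdiv_lt_0_compat; lra).
  set (q := rho + Gamma * delta).
  assert (Hq : 0 < q < 1).
  { assert (E : q = (1 + rho) / 2) by (unfold q, delta; field; lra). lra. }
  exists (Rmin (1 / 2) (delta / (4 * (K + 1)))), (Rmin 1 (delta / (2 * Cg))).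
  split; [apply Rmin_pos; [lra|apply Rdiv_lt_0_compat; lra]|].
  split; [apply Rmin_pos; [lra|apply Rdiv_lt_0_compat; lra]|].
  intros eps L phi lmax [Heps0 Heps] [HL0 HL1] Hphi0 HL Hlmax.
  pose proof (Rle_trans _ _ _ Heps (Rmin_l _ _)) as Heps_half.
  pose proof (Rle_trans _ _ _ Heps (Rmin_r _ _)) as Heps_delta.
  pose proof (Rle_trans _ _ _ HL1 (Rmin_l _ _)) as HL_one.
  pose proof (Rle_trans _ _ _ HL1 (Rmin_r _ _)) as HL_delta.
  assert (Hpert : 2 * K * eps + L * Cg <= delta).
  { apply Rmult_le_compat_l with (r := 4 * (K + 1)) in Heps_delta; [|lra].
    replace (4 * (K + 1) * (delta / (4 * (K + 1)))) with delta in Heps_delta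
      by (field; lra).
    apply Rmult_le_compat_l with (r := 2 * Cg) in HL_delta; [|lra].
    replace (2 * Cg * (delta / (2 * Cg))) with delta in HL_delta by (field; lra). nra. }
  assert (Hexists := held_trajectory_exists j T Tm1 B F HT HTm1 Hext Hj Hinj G HG HG0
    phi L HL0 HL).
  assert (Hunique := hold_solution_unique j T Tm1 B F HT HTm1 Hext Hj Hinj G HG
    phi L HL0 HL).
  exists (2 * Cg * Gamma / q), (- ln q / h).
  assert (HGq : 1 <= 2 * Cg * Gamma / q).
  { apply (Rmult_le_reg_r q); [lra|].
    replace (2 * Cg * Gamma / q * q) with (2 * Cg * Gamma) by (field; lra). nra. }
  split; [exact HGq|]. split.
  { apply Rdiv_lt_0_compat; [|exact hh].
    assert (ln q < 0) by (rewrite -ln_1; apply ln_increasing; lra). lra. }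
  intros x0.
  destruct (event_triggered_solution_exists j T Tm1 B F phi Hexists Hunique h eps lmax
    hh Heps0 Hlmax x0) as (x & Hx & Hx0 & Hsampled).
  exists x. split; [exact Hx|]. split.
  { intros y Hy. exact (event_triggered_solution_unique j T Tm1 B F phi Hexists Hunique
      h eps lmax hh Heps0 Hlmax x0 x y Hx Hy). }
  assert (Hstep : forall n,
    (forall b, 0 <= b <= h ->
       norm (x (INR n * h + b)) <= 2 * Cg * norm (x (INR n * h))) /\
    norm (minus (x (INR (S n) * h)) (linear_response T G (x (INR n * h)) h)) <=
      delta * norm (x (INR n * h))).
  { intros n. destruct (Hsampled n) as (xi & z & a & Hz & Ha & Hdiff & Hxz).
    assert (Exa : x (INR n * h) = z a).
    { rewrite -(Rplus_0_r a) -Hxz; [now rewrite Rplus_0_r|lra]. }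
    assert (Hxi : norm xi <= 2 * norm (z a)).
    { pose proof (norm_le_norm_minus (z a) xi) as H. rewrite (norm_minus_sym xi) in H.
      pose proof (norm_ge_0 xi). nra. }
    split.
    - intros b Hb. rewrite Hxz // Exa.
      eapply Rle_trans; [now apply (held_trajectory_growth j T Tm1 B F HT HTm1 Hext Hj
        Hinj h G HG phi L HL0 HL M K HM1 HM HK0 HK HL_one Hphi0 xi z a)|].
      replace (2 * Cg * norm (z a)) with
        (2 * ((M + 2 * K) * norm (z a)) * exp (2 * M * h)) by (unfold Cg; ring).
      apply Rmult_le_compat_l; [|apply exp_monotone; nra].
      repeat apply Rmult_le_pos; try lra. apply norm_ge_0.
    - rewrite S_INR Rmult_plus_distr_r Rmult_1_l Hxz; [|lra]. rewrite Exa.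
      eapply Rle_trans; [now apply (held_trajectory_step j T Tm1 B F HT HTm1 Hext Hj
        Hinj hB HF h hh G HG phi L HL0 HL M K HM1 HM HK0 HK HL_one Hphi0 xi z a eps)|].
      apply Rmult_le_compat_r; [apply norm_ge_0|exact Hpert]. }
  assert (Hdecay : forall n, norm (x (INR n * h)) <= Gamma * q ^ n * norm x0).
  { intros n. rewrite -Hx0. replace 0 with (INR 0 * h) by (simpl; ring).
    apply (perturbed_power_stable (fun y => linear_response T G y h) Gamma rho delta
      (fun n => x (INR n * h))); try lra.
    - intros x1 x2. apply (linear_response_minus j T Tm1 B F); try assumption. lra.
    - exact Hpow.
    - intros m. apply Hstep. }
  intros t Ht.
  replace (2 * Cg * Gamma / q * exp (- (- ln q / h) * t) * norm x0) with
    (2 * Cg * Gamma * norm x0 / q * exp (- (- ln q / h) * t)) by (field; lra).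
  apply (sampled_decay (fun s => norm (x s)) h q); try assumption.
  - apply Rmult_le_pos; [nra|apply norm_ge_0].
  - intros n b Hb. eapply Rle_trans; [now apply Hstep|].
    replace (2 * Cg * Gamma * norm x0 * q ^ n) with (2 * Cg * (Gamma * q ^ n * norm x0))
      by ring.
    apply Rmult_le_compat_l; [lra|apply Hdecay].
Qed.
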